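(* Let $\mathcal H$ be a complex Hilbert space. The norm closure in $\mathcal B(\mathcal H)$ of the group of all invertible bounded operators on $\mathcal H$ is the set of all $A\in\mathcal B(\mathcal H)$ such that $\iota_i(A)=\iota_f(A)$.
   Context: Hilbert spaces are complex and of arbitrary dimension; $\dim$ is the Hilbert space dimension (the cardinality of an orthonormal basis), and sums of dimensions are cardinal sums. $\mathcal B(\mathcal H)$ is the space of bounded linear operators on $\mathcal H$. $\mathcal N(A)$, $\mathcal R(A)$, $\overline{\mathcal R}(A)$ denote the kernel, the range and the closure of the range of $A$. For a pre-Hilbert space $\mathcal E$ with completion $\overline{\mathcal E}$, $\mathrm{IC}(\mathcal E)=\min\{\dim(\overline{\mathcal E}\ominus V): V \text{ a complete linear subspace of }\mathcal E\}$ ($\ominus$ denotes orthogonal complement). For $A\in\mathcal B(\mathcal H)$: $\iota_i(A)=\dim\mathcal N(A)+\mathrm{IC}(\mathcal R(A))$ and $\iota_f(A)=\dim(\mathcal H\ominus\overline{\mathcal R}(A))+\mathrm{IC}(\mathcal R(A))$. *)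

(* Defs.v *)
From HB Require Import structures.
From mathcomp Require Import all_boot all_order all_algebra complex.
From mathcomp Require Import all_classical all_reals all_analysis.

Set Implicit Arguments.
Unset Strict Implicit.
Unset Printing Implicit Defensive.

Import Order.TTheory GRing.Theory Num.Theory Num.Def.
Import numFieldNormedType.Exports.

Local Open Scope classical_set_scope.
Local Open Scope complex_scope.
Local Open Scope ring_scope.

Section BoundedOperators.
Context {R : realType}.

Definition bounded_linear (H : normedModType R[i]) : {pred H -> H} :=
  fun f => `[< linear f /\
               exists M : R[i], forall x : H, `|f x| <= M * `|x| >].

Record bop (H : normedModType R[i]) := Bop {
  bop_fun :> H -> H;
  bop_subproof : bop_fun \in @bounded_linear H }.

Context (H : normedModType R[i]).

HB.instance Definition _ := [isSub for @bop_fun H].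
HB.instance Definition _ := [Choice of bop H by <:].

Lemma bounded_linear_submod_closed : submod_closed (@bounded_linear H).
Proof.
split=> [|a f g /asboolP[lf [M fM]] /asboolP[lg [N gN]]]; apply/asboolP; split.
- by move=> k x y /=; rewrite scaler0 addr0.
- by exists 0 => x; rewrite normr0 mul0r.
- move=> k x y.
  rewrite -[LHS]/(a *: f (k *: x + y) + g (k *: x + y)).
  rewrite -[RHS]/(k *: (a *: f x + g x) + (a *: f y + g y)).
  by rewrite lf lg !scalerDr !scalerA [k * a]mulrC addrACA.
- exists (`|a| * M + N) => x; rewrite -[X in `|X|]/(a *: f x + g x) mulrDl -mulrA.
  by rewrite (le_trans (ler_normD _ _))// lerD// normrZ ler_wpM2l.
Qed.

HB.instance Definition _ := GRing.isSubmodClosed.Build _ _ (@bounded_linear H)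
  bounded_linear_submod_closed.
HB.instance Definition _ := [SubChoice_isSubLmodule of bop H by <:].

(* Norms of vectors are elements of R[i] with zero imaginary part; Re only
   brings them back to R, where suprema exist. *)
Definition opnorm (A : H -> H) : R :=
  sup [set complex.Re `|A x| | x in [set x : H | `|x| <= 1]].

Lemma Re_normE (x : H) : (complex.Re `|x|)%:C = `|x|.
Proof. by rewrite RRe_real// normr_real. Qed.

Lemma bopD (A B : bop H) x : (A + B : bop H) x = A x + B x. Proof. by []. Qed.

Lemma bopZ (a : R[i]) (A : bop H) x :
  (a *: A : bop H) x = a *: A x.
Proof. by []. Qed.

Lemma bop_linear (A : bop H) : linear A.
Proof. by case: A => f /= /asboolP[]. Qed.

Lemma bop_scale (A : bop H) (a : R[i]) (x : H) : A (a *: x) = a *: A x.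
Proof.
have A0 : A 0 = 0 by have := bop_linear A (-1) 0 0; rewrite scaler0 addr0 scaleN1r addNr.
by have := bop_linear A a x 0; rewrite addr0 A0 addr0.
Qed.

Lemma bop_has_sup (A : bop H) :
  has_sup [set complex.Re `|A x| | x in [set x : H | `|x| <= 1]].
Proof.
case: A => f /= /asboolP[_ [M fM]]; split.
  by exists (complex.Re `|f 0|), 0 => //=; rewrite normr0.
pose K : R[i] := `|M|; have K_real : K \is Num.real by exact: normr_real.
exists (complex.Re K) => _ [x /= x1 <-].
rewrite -lecR !RRe_real ?normr_real//.
have Mx0 : 0 <= M * `|x| by exact: le_trans (fM x).
rewrite (le_trans (fM x))// -(ger0_norm Mx0) normrM normr_id.
by rewrite ler_piMr// normr_ge0.
Qed.

Lemma opnorm_ub (A : bop H) (x : H) : `|x| <= 1 -> `|A x| <= (opnorm A)%:C.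
Proof.
move=> x1; rewrite -Re_normE lecR.
by apply: ub_le_sup; [exact: (bop_has_sup A).2|exists x].
Qed.

Lemma opnorm_le (A : bop H) (c : R) :
  (forall x : H, `|x| <= 1 -> `|A x| <= c%:C) -> opnorm A <= c.
Proof.
move=> Ac; apply: ge_sup; first exact: (bop_has_sup A).1.
by move=> _ [x /= x1 <-]; rewrite -lecR Re_normE; exact: Ac.
Qed.

Lemma opnorm_ge0 (A : bop H) : 0 <= opnorm A.
Proof.
by rewrite -lecR; apply: le_trans (@opnorm_ub A 0 _); rewrite ?normr0.
Qed.

Lemma opnormD (A B : bop H) :
  (opnorm (A + B : bop H))%:C <= (opnorm A)%:C + (opnorm B)%:C :> R[i].
Proof.
rewrite -rmorphD lecR; apply: opnorm_le => x x1.
by rewrite bopD (le_trans (ler_normD _ _))// rmorphD lerD// opnorm_ub.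
Qed.

Lemma opnormZ (a : R[i]) (A : bop H) :
  (opnorm (a *: A : bop H))%:C = `|a| * (opnorm A)%:C :> R[i].
Proof.
have leZ (b : R[i]) (B : bop H) :
    (opnorm (b *: B : bop H))%:C <= `|b| * (opnorm B)%:C :> R[i].
  have [r br] : exists r : R, `|b| = r%:C.
    by exists (complex.Re `|b|); rewrite RRe_real// normr_real.
  rewrite br -rmorphM lecR; apply: opnorm_le => x x1.
  by rewrite bopZ normrZ rmorphM/= -br ler_wpM2l// opnorm_ub.
apply/eqP; rewrite eq_le leZ andTb.
have [->|a0] := eqVneq a 0; first by rewrite normr0 mul0r ler0c (opnorm_ge0 (0 *: A)).
have := leZ a^-1 (a *: A); rewrite scalerA mulVf// scale1r normfV.
by rewrite ler_pdivlMl ?normr_gt0.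
Qed.

Lemma opnorm_eq0 (A : bop H) : (opnorm A)%:C = 0 :> R[i] -> A = 0.
Proof.
move=> A0; apply/val_inj/funext => x; change (A x = 0).
have [->|x0] := eqVneq x 0; first by rewrite -[X in A X](scale0r 0) bop_scale scale0r.
have nx0 : `|x| != 0 by rewrite normr_eq0.
have : `|A (`|x|^-1 *: x)| <= (opnorm A)%:C.
  by apply: opnorm_ub; rewrite normrZ normfV normr_id mulVf.
rewrite A0 normr_le0 bop_scale scaler_eq0 invr_eq0 (negbTE nx0)/=.
by move/eqP.
Qed.

HB.instance Definition _ := @Lmodule_isNormed.Build R[i] (bop H)
  (fun A => (opnorm A)%:C) opnormD opnormZ opnorm_eq0.

Definition invertible_bop (A : bop H) : Prop :=
  exists B : bop H, A \o B = id /\ B \o A = id.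

End BoundedOperators.

Section Cardinals.

(* A cardinal number is represented by any set of that cardinality: equality of
   cardinals is #= and their order is #<=. *)
Definition card_add (T U : Type) (A : set T) (B : set U) : set (T + U) :=
  (inl @` A) `|` (inr @` B).

Definition card_min (T : Type) (K : set (set T)) : set T :=
  get [set k | K k /\ forall l, K l -> (k #<= l)%card].

(* Well-ordering of cardinals: a maximal set of pairwise everywhere distinct
   choice functions of K projects onto some member of K. *)
Lemma card_minP (T : pointedType) (K : set (set T)) : K !=set0 ->
  K (card_min K) /\ forall l, K l -> (card_min K #<= l)%card.
Proof.
move=> [k0 Kk0]; apply: (@getPex _ [set k | K k /\ _]).
pose P : set (set (set T -> T)) := [set F | forall g, F g ->
  (forall k, K k -> k (g k)) /\
  (forall h k, F h -> K k -> g k = h k -> g = h)].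
have [|F [PF Fmax]] := @Zorn_bigcup _ P.
  move=> S SP tot g [X SX Xg]; split; first exact: (SP _ SX _ Xg).1.
  move=> h k [Y SY Yh] Kk; have [XY|YX] := tot _ _ SX SY.
    by apply: (SP _ SY _ (XY _ Xg)).2.
  by apply: (SP _ SX _ Xg).2 => //; exact: YX.
have [[k [Kk kF]]|noF] :=
    pselect (exists k, K k /\ forall x, k x -> exists2 g, F g & g k = x).
  exists k; split=> // l Kl; apply/pcard_geP/surjPex.
  pose G (y : T) := (get [set g | F g /\ g l = y]) k.
  exists G => x kx; have [g Fg gx] := kF x kx.
  exists (g l); first exact: (PF _ Fg).1.
  rewrite /G; case: (@getPex _ [set h | F h /\ h l = g l]); first by exists g.
  by move=> Fh /((PF _ Fh).2 _ _ Fg Kl) ->.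
have ex k : exists x, K k -> k x /\ forall g, F g -> g k <> x.
  have [Kk|nKk] := pselect (K k); last by exists point.
  apply: contrapT => nx; apply: noF; exists k; split=> // x kx.
  apply: contrapT => ng; apply: nx; exists x => _; split=> // g Fg gx.
  by apply: ng; exists g.
have [f fP] := choice ex.
have nFf : ~ F f by move=> Ff; exact: (fP k0 Kk0).2 Ff erefl.
case: (Fmax (F `|` [set f])).
  split; first by move=> g; left.
  by move=> /(_ f) FF; apply: nFf; apply: FF; right.
move=> g [Fg|->]; split.
- exact: (PF _ Fg).1.
- move=> h k [Fh|->] Kk; first exact: (PF _ Fg).2.
  by move=> gf; case: ((fP k Kk).2 _ Fg gf).
- by move=> k Kk; exact: (fP k Kk).1.
- move=> h k [Fh|->//] Kk fh; by case: ((fP k Kk).2 _ Fh (esym fh)).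
Qed.

End Cardinals.

Section HilbertDimension.
Context {R : realType} {H : completeNormedModType R[i]}.
Variable form : {dot H for conjC}.
Implicit Types E V M B : set H.

Definition complete_set V : Prop :=
  forall F : set_system H, ProperFilter F -> F V -> cauchy F ->
    exists2 x, V x & F --> x.

Definition ominus M V : set H :=
  [set x | M x /\ forall v, V v -> form x v = 0].

Definition orthonormal_set B : Prop :=
  forall x y, B x -> B y -> form x y = (x == y)%:R.

(* Maximality among the orthonormal subsets of M; for complete M, as in all uses
   below, it amounts to B having a dense linear span in M. *)
Definition orthonormal_basis M B : Prop :=
  [/\ B `<=` M, orthonormal_set B &
      forall C, C `<=` M -> orthonormal_set C -> B `<=` C -> C = B].

Definition hdim M : set H := get (orthonormal_basis M).

Lemma hdimP M : orthonormal_basis M (hdim M).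
Proof.
apply: getPex; pose P : set (set H) := [set B | B `<=` M /\ orthonormal_set B].
have [|B [[BM oB] Bmax]] := @Zorn_bigcup _ P.
  move=> S SP tot; split=> [x [X SX Xx]|x y [X SX Xx] [Y SY Yy]].
    exact: (SP _ SX).1 Xx.
  have [XY|YX] := tot _ _ SX SY.
    by apply: (SP _ SY).2 => //; exact: XY.
  by apply: (SP _ SX).2 => //; exact: YX.
exists B; split=> // C CM oC BC; apply/eqP/negPn/negP => /eqP CB.
apply: (Bmax C); last by split.
by split=> // CB'; apply: CB; apply/seteqP.
Qed.

(* The closure in H of a linear subspace E is the completion of E. *)
Definition IC E : set H :=
  card_min [set hdim (ominus (closure E) V) | V in
    [set V | [/\ V `<=` E, submod_closed [in V] & complete_set V]]].

Definition iota_i (A : bop H) : set (H + H) :=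
  card_add (hdim (A @^-1` [set 0])) (IC (range A)).

Definition iota_f (A : bop H) : set (H + H) :=
  card_add (hdim (ominus [set: H] (closure (range A)))) (IC (range A)).

End HilbertDimension.

(* Main.v *)
Require Import Defs.
From HB Require Import structures.
From mathcomp Require Import all_boot all_order all_algebra complex.
From mathcomp Require Import all_classical all_reals all_analysis.
From mathcomp Require Import ring lra.
Import Order.TTheory GRing.Theory Num.Theory Num.Def.
Import numFieldNormedType.Exports.
Local Open Scope classical_set_scope.
Local Open Scope complex_scope.
Local Open Scope ring_scope.
Set Implicit Arguments.
Unset Strict Implicit.
Unset Printing Implicit Defensive.

(** The idea is to read both indices as codimensions. Let W be a closed subspace
    orthogonal to the kernel of A on which A is bounded below. Then A @` W is a
    closed subspace of the range, W and A @` W have the same relative codimension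
    in the complement of the kernel and in the closure of the range
    (hdim_ominus_image), and hence
      codim W = dim (ker A) + d,  codim (A @` W) = codim (closure of range) + d
    where d is this common codimension (hdim_perp_domain, hdim_perp_image). Every
    complete subspace V of the range is such an A @` W
    (bounded_below_of_range, a form of the open mapping theorem obtained from
    the uniform boundedness principle), so IC is the smallest possible d, and for
    that d the two codimensions are iota_i and iota_f.

    If A is a limit of invertible operators, take W realizing IC and an
    invertible B close to A. Then W, B @` W and A @` W have the same codimension,
    the first two because B is invertible, the last two because the images are
    close (hdim_perp_image_le); hence iota_i = iota_f.

    Conversely, for every e > 0 there is such a W with nrm (A x) <= e * nrm x on
    its orthogonal complement (spectral_subspace): it is cut out by the sign of
    S = A* A - e ^ 2, that is, by the kernel of |S| + S, and |S| is a limit of an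
    explicit iteration (exists_sqrt). If iota_i = iota_f, then adding the part of
    d beyond IC shows that W and A @` W have equal codimensions
    (card_add_absorb). An isometry between their complements (exists_isometry),
    multiplied by e and combined with A on W, gives an invertible operator
    within 2 * e of A.

    Equalities of dimensions always come from bounded injective maps in both
    directions (hdim_le). *)

(** * Norms and scalar products *)

Section RealNorm.
Context {R : realType}.

(** Norms are elements of R[i] with zero imaginary part; nrm is the same number
    in the archimedean field R, where infima and suprema exist. *)
Definition nrm (V : normedZmodType R[i]) (x : V) : R := complex.Re `|x|.

Section Zmod.
Context (V : normedZmodType R[i]).
Implicit Types x y : V.

Lemma nrmE x : (nrm x)%:C = `|x|.
Proof. by rewrite RRe_real// normr_real. Qed.

Lemma nrm_ge0 x : 0 <= nrm x.
Proof. by rewrite -ler0c nrmE. Qed.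

Lemma nrm_eq0 x : (nrm x == 0) = (x == 0).
Proof. by rewrite -(inj_eq (@complexI R)) nrmE normr_eq0. Qed.

Lemma nrm0 : nrm (0 : V) = 0.
Proof. by apply/eqP; rewrite nrm_eq0. Qed.

Lemma nrm_gt0 x : (0 < nrm x) = (x != 0).
Proof. by rewrite lt_def nrm_ge0 nrm_eq0 andbT. Qed.

Lemma nrmN x : nrm (- x) = nrm x.
Proof. by rewrite /nrm normrN. Qed.

Lemma nrm_distC x y : nrm (x - y) = nrm (y - x).
Proof. by rewrite -nrmN opprB. Qed.

Lemma nrmD x y : nrm (x + y) <= nrm x + nrm y.
Proof. by rewrite -lecR rmorphD/= !nrmE ler_normD. Qed.

Lemma nrmB x y : nrm (x - y) <= nrm x + nrm y.
Proof. by rewrite -[nrm y]nrmN nrmD. Qed.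

Lemma nrm_triangle y x z : nrm (x - z) <= nrm (x - y) + nrm (y - z).
Proof. by rewrite -{1}(subrK y x) -addrA nrmD. Qed.

Lemma nrm_small_eq0 x : (forall e, 0 < e -> nrm x < e) -> x = 0.
Proof.
move=> xe; apply/eqP; rewrite -nrm_eq0 eq_le nrm_ge0 andbT leNgt.
by apply/negP => /xe; rewrite ltxx.
Qed.

End Zmod.

Lemma nrmM (a b : R[i]) : nrm (a * b) = nrm a * nrm b.
Proof. by apply: complexI; rewrite rmorphM/= !nrmE normrM. Qed.

Lemma nrm_real (r : R) : nrm r%:C = `|r|.
Proof.
by apply: complexI; rewrite nrmE normc_def /= expr0n addr0 sqrtr_sqr.
Qed.

Lemma ler_Re_nrm (a : R[i]) : complex.Re a <= nrm a.
Proof.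
by rewrite (le_trans (ler_norm _))// -lecR nrmE normc_ge_Re.
Qed.

Lemma nrmZ (V : normedModType R[i]) a (x : V) : nrm (a *: x) = nrm a * nrm x.
Proof. by apply: complexI; rewrite rmorphM/= !nrmE normrZ. Qed.

Lemma exists_small (e : R) : 0 < e -> exists N : nat, N.+1%:R^-1 < e.
Proof.
move=> e0; have /archi_boundP eN : 0 <= e^-1 by rewrite invr_ge0 ltW.
exists (archi_bound e^-1); rewrite invf_plt ?posrE//.
by rewrite (lt_trans eN)// ltr_nat.
Qed.

End RealNorm.

(** Being a class, this hypothesis is filled in by instance search whenever a
    lemma is used with a given form. *)
Class norm_of_form {R : realType} {H : completeNormedModType R[i]}
    (form : {dot H for conjC}) : Prop :=
  norm_of_formE : forall x : H, `|x| ^+ 2 = form x x.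

Section InnerProduct.
Context {R : realType} {H : completeNormedModType R[i]}
        {form : {dot H for conjC}} {nf : norm_of_form form}.
Implicit Types x y z : H.
Local Notation "''[' x , y ]" := (form x y) : ring_scope.

Lemma formC x y : '[x, y] = '[y, x]^*.
Proof. by rewrite hermC expr0 mul1r. Qed.

Lemma formZl a x y : '[a *: x, y] = a * '[x, y].
Proof. by rewrite linearZl_LR. Qed.

Lemma formZr a x y : '[x, a *: y] = a^* * '[x, y].
Proof. by rewrite linearZr_LR. Qed.

Lemma form_eq0C x y : '[x, y] = 0 -> '[y, x] = 0.
Proof. by move=> xy; rewrite formC xy conjC0. Qed.

Lemma formxx x : '[x, x] = ((nrm x) ^+ 2)%:C.
Proof. by rewrite -norm_of_formE rmorphXn/= nrmE. Qed.

Lemma nrm2D x y :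
  nrm (x + y) ^+ 2 = nrm x ^+ 2 + nrm y ^+ 2 + 2 * complex.Re '[x, y].
Proof.
have -> : nrm (x + y) ^+ 2 = complex.Re '[x + y, x + y] by rewrite formxx.
rewrite dnormD 2!formxx (addcJ _) !raddfD /=.
by rewrite mulr0 subr0.
Qed.

Lemma nrm2B x y :
  nrm (x - y) ^+ 2 = nrm x ^+ 2 + nrm y ^+ 2 - 2 * complex.Re '[x, y].
Proof. by rewrite nrm2D nrmN linearNr raddfN mulrN. Qed.

Lemma parallelogram x y :
  nrm (x + y) ^+ 2 + nrm (x - y) ^+ 2 = 2 * (nrm x ^+ 2 + nrm y ^+ 2).
Proof. by rewrite nrm2D nrm2B; ring. Qed.

Lemma pythagoras x y : '[x, y] = 0 ->
  nrm (x + y) ^+ 2 = nrm x ^+ 2 + nrm y ^+ 2.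
Proof. by move=> xy; rewrite nrm2D xy /= mulr0 addr0. Qed.

(** Subtracting from x its component a y along y leaves a vector orthogonal to
    y, so that a y is not longer than x. *)
Lemma cauchy_schwarz x y : nrm '[x, y] <= nrm x * nrm y.
Proof.
have [->|y0] := eqVneq y 0; first by rewrite linear0r !nrm0 mulr0.
have fy0 : '[y, y] != 0 by rewrite dnorm_eq0.
pose a := '[x, y] / '[y, y]; pose u := x - a *: y.
have uy : '[u, y] = 0 by rewrite linearBl/= formZl divfK// subrr.
have ax : nrm a * nrm y <= nrm x.
  rewrite -nrmZ -(@ler_pXn2r _ 2)// ?nnegrE ?nrm_ge0//.
  rewrite -[in leRHS](subrK (a *: y) x) pythagoras ?lerDr ?sqr_ge0//.
  by rewrite formZr uy mulr0.
have -> : '[x, y] = a * '[y, y] by rewrite divfK.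
rewrite nrmM formxx nrm_real ger0_norm ?sqr_ge0// expr2 mulrA.
by rewrite ler_wpM2r ?nrm_ge0.
Qed.

End InnerProduct.

Arguments parallelogram {R H form} nf x y.

(** * Closed sets and limits *)

Section Closure.
Context {R : realType} {H : normedModType R[i]}.
Implicit Types (x y : H) (V : set H).

Lemma real_ball x (B : set H) :
  nbhs x B <-> exists2 e : R, 0 < e & forall y, nrm (x - y) < e -> B y.
Proof.
split=> [/nbhs_normP[e /= e0 eB]|[e e0 eB]].
  have er : (complex.Re e)%:C = e by rewrite RRe_real// gtr0_real.
  exists (complex.Re e) => [|y xy]; first by rewrite -ltcR er.
  by apply: eB; rewrite /ball_/= -nrmE -er ltcR.
apply/nbhs_normP; exists e%:C; first by rewrite /= ltcR.
by move=> y; rewrite /ball_/= -nrmE ltcR; exact: eB.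
Qed.

Lemma closure_nrmP V x :
  closure V x <-> forall e : R, 0 < e -> exists2 v, V v & nrm (x - v) < e.
Proof.
split=> [Vx e e0|Vx B /real_ball[e e0 eB]].
  have [|v [Vv xv]] := Vx [set y | nrm (x - y) < e]; last by exists v.
  by apply/real_ball; exists e.
by have [v Vv xv] := Vx e e0; exists v; split=> //; exact: eB.
Qed.

Lemma closed_nrmP V : closed V <->
  forall x, (forall e : R, 0 < e -> exists2 v, V v & nrm (x - v) < e) -> V x.
Proof.
split=> [cV x /closure_nrmP/cV//|cV x /closure_nrmP]; exact: cV.
Qed.

End Closure.

Section Limits.
Context {R : realType} {H : completeNormedModType R[i]}.
Implicit Types (x y : H) (u : nat -> H) (V : set H).

Definition converges u l := forall e : R, 0 < e ->
  exists N, forall n, (N <= n)%N -> nrm (u n - l) < e.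

Lemma cauchy_converges u :
  (forall e : R, 0 < e ->
     exists N, forall m n, (N <= m)%N -> (N <= n)%N -> nrm (u m - u n) < e) ->
  exists l, converges u l.
Proof.
move=> cu; have /cauchy_cvgP : cauchy (u @ \oo).
  apply/cauchy_ballP => e e0.
  have er : (complex.Re e)%:C = e by rewrite RRe_real// gtr0_real.
  have [|N uN] := cu (complex.Re e); first by rewrite -ltcR er.
  exists (u @` [set n | (N <= n)%N], u @` [set n | (N <= n)%N]).
    by split; exists N => // n /= Nn; exists n.
  move=> [_ _] [/= [m Nm <-] [n Nn <-]].
  by rewrite -ball_normE/= -nrmE -er ltcR uN.
move=> /cvg_ex[l ul]; exists l => e e0.
have /ul : nbhs l [set y | nrm (l - y) < e] by apply/real_ball; exists e.
by move=> [N _ uN]; exists N => n Nn; rewrite nrm_distC; exact: uN.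
Qed.

Lemma closed_converges V u l :
  closed V -> (forall n, V (u n)) -> converges u l -> V l.
Proof.
move=> /closed_nrmP cV Vu ul; apply: cV => e /ul[N uN].
by exists (u N) => //; rewrite nrm_distC uN.
Qed.

(** If x is adherent to V, the trace on V of the neighbourhoods of x is a Cauchy
    filter, and completeness of V puts its limit x in V. *)
Lemma complete_setP V : complete_set V <-> closed V.
Proof.
split=> [cV|cV F FF FV cF].
  apply/closed_nrmP => x /closure_nrmP xV.
  have xF : ProperFilter (within V (nbhs x)) by exact: within_nbhs_proper.
  have [||y Vy Fy] := cV (within V (nbhs x)).
  - by exact: withinT.
  - by apply: cvg_cauchy; apply/cvg_ex; exists x; exact: cvg_within.
  suff <- : y = x by [].
  by apply: (@cvg_unique _ _ (within V (nbhs x))) => //; exact: cvg_within.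
have /cauchy_cvgP/cvg_ex[l Fl] := cF.
exists l => //; apply: cV => B /Fl FB.
by have [v [Bv Vv]] := filter_ex (filterI FV FB); exists v.
Qed.

End Limits.

(** * Bounded operators, projections and adjoints *)

HB.instance Definition _ (R : realType) (H : normedModType R[i]) (A : bop H) :=
  GRing.isLinear.Build R[i] H H _ (bop_fun A) (bop_linear A).

Section Operators.
Context {R : realType} {H : completeNormedModType R[i]}.
Implicit Types (x y : H) (V W : set H) (A B : bop H).

Lemma bop_bounded A : exists2 M : R, 0 < M & forall x, nrm (A x) <= M * nrm x.
Proof.
have /asboolP[_ [M AM]] := bop_subproof A.
exists (nrm M + 1) => [|x]; first by rewrite ltr_wpDl ?nrm_ge0.
rewrite (@le_trans _ _ (nrm M * nrm x))//; last first.
  by rewrite ler_wpM2r ?nrm_ge0// lerDl.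
rewrite -lecR rmorphM/= !nrmE (le_trans (AM x))//.
have Mx0 : 0 <= M * `|x| by exact: le_trans (AM x).
by rewrite -(ger0_norm Mx0) normrM normr_id.
Qed.

Lemma bop_make (f : H -> H) : linear f ->
  (exists M : R, forall x, nrm (f x) <= M * nrm x) ->
  exists A : bop H, forall x, A x = f x.
Proof.
move=> lf [M fM]; have bf : f \in @bounded_linear R H.
  apply/asboolP; split=> //; exists M%:C => x.
  by rewrite -!nrmE -rmorphM lecR.
by exists (Bop bf).
Qed.

Lemma bop_comp A B : exists C : bop H, forall x, C x = A (B x).
Proof.
apply: bop_make => [a x y|]; first by rewrite !linearP.
have [M M0 AM] := bop_bounded A; have [N N0 BN] := bop_bounded B.
exists (M * N) => x; rewrite (le_trans (AM _))// -mulrA.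
by rewrite ler_wpM2l// ltW.
Qed.

Lemma bop_id : exists A : bop H, forall x, A x = x.
Proof. by apply: bop_make => //; exists 1 => x; rewrite mul1r. Qed.

Lemma bop_converges A u l : converges u l -> converges (A \o u) (A l).
Proof.
have [M M0 AM] := bop_bounded A.
move=> ul e e0; have [|N uN] := ul (e / M); first exact: divr_gt0.
exists N => n Nn /=; rewrite -linearB/= (le_lt_trans (AM _))//.
by rewrite mulrC -ltr_pdivlMr// uN.
Qed.

Definition subspace V := V 0 /\ forall a x y, V x -> V y -> V (a *: x + y).

Lemma subspaceZ V a x : subspace V -> V x -> V (a *: x).
Proof. by move=> [V0 sV] Vx; rewrite -[_ *: _]addr0; exact: sV. Qed.

Lemma subspaceD V x y : subspace V -> V x -> V y -> V (x + y).
Proof. by move=> [V0 sV] Vx Vy; rewrite -[x]scale1r; exact: sV. Qed.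

Lemma subspaceB V x y : subspace V -> V x -> V y -> V (x - y).
Proof. by move=> [V0 sV] Vx Vy; rewrite addrC -scaleN1r; exact: sV. Qed.

Lemma subspace_submod V : submod_closed [in V] <-> subspace V.
Proof.
split=> [[V0 sV]|[V0 sV]]; split.
- by move: V0; rewrite inE.
- by move=> a x y Vx Vy; have := sV a x y; rewrite !inE; exact.
- by rewrite inE.
- by move=> a x y; rewrite !inE => ? ?; exact: sV.
Qed.

Lemma subspace_image A V : subspace V -> subspace (A @` V).
Proof.
move=> [V0 sV]; split; first by exists 0 => //; rewrite linear0.
move=> a _ _ [x Vx <-] [y Vy <-]; exists (a *: x + y); first exact: sV.
by rewrite linearP.
Qed.

Lemma subspace_preimage A V : subspace V -> subspace (A @^-1` V).
Proof.
move=> [V0 sV]; split; first by rewrite /= linear0.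
by move=> a x y /= Vx Vy; rewrite linearP; exact: sV.
Qed.

Lemma closed_preimage_bop A V : closed V -> closed (A @^-1` V).
Proof.
move=> /closed_nrmP cV; apply/closed_nrmP => x xV; apply: cV => e e0.
have [M M0 AM] := bop_bounded A.
have [|y /= Vy xy] := xV (e / M); first exact: divr_gt0.
exists (A y) => //; rewrite -linearB/= (le_lt_trans (AM _))//.
by rewrite mulrC -ltr_pdivlMr.
Qed.

Lemma closed_zero : closed [set 0 : H].
Proof.
apply/closed_nrmP => x x0; apply: nrm_small_eq0 => e /x0[v /= ->].
by rewrite subr0.
Qed.

Lemma subspace_zero : subspace [set 0 : H].
Proof. by split=> //= a x y -> ->; rewrite scaler0 addr0. Qed.

Lemma subspace_closure V : subspace V -> subspace (closure V).
Proof.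
move=> sV; split; first by apply: subset_closure; exact: sV.1.
move=> a x y /closure_nrmP xV /closure_nrmP yV; apply/closure_nrmP => e e0.
have a0 : 0 < nrm a + 1 by rewrite ltr_wpDl ?nrm_ge0.
have [|v Vv xv] := xV (e / 2 / (nrm a + 1)); first by rewrite !divr_gt0.
have [|w Vw yw] := yV (e / 2); first by rewrite divr_gt0.
exists (a *: v + w); first exact: sV.2.
rewrite opprD addrACA -scalerBr [e in _ < e]splitr (le_lt_trans (nrmD _ _))//.
rewrite ler_ltD// nrmZ (@le_trans _ _ ((nrm a + 1) * nrm (x - v)))//.
  by rewrite ler_wpM2r ?nrm_ge0// lerDl.
by rewrite mulrC -ler_pdivlMr// ltW.
Qed.

End Operators.

Section Projection.
Context {R : realType} {H : completeNormedModType R[i]}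
        {form : {dot H for conjC}} {nf : norm_of_form form}.
Implicit Types (x y : H) (V W M : set H) (A B : bop H).
Local Notation "''[' x , y ]" := (form x y) : ring_scope.

(** A minimizing sequence for the distance from x to M is Cauchy by the
    parallelogram law, since midpoints stay in M; its limit p is a nearest point,
    and x - p is orthogonal to M because moving p inside M cannot bring it closer
    to x. *)
Lemma projection_theorem M x : subspace M -> closed M ->
  exists2 p, M p & forall m, M m -> '[x - p, m] = 0.
Proof.
move=> sM cM; pose S := [set nrm (x - m) | m in M].
have S0 : S !=set0 by exists (nrm (x - 0)), 0 => //; exact: sM.1.
have lS : has_lbound S by exists 0 => _ [m _ <-]; exact: nrm_ge0.
pose d := inf S.
have d0 : 0 <= d by apply: lb_le_inf => // _ [m _ <-]; exact: nrm_ge0.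
have dM m : M m -> d <= nrm (x - m) by move=> Mm; apply: ge_inf => //; exists m.
have /choice[u uP] (n : nat) : exists m, M m /\ nrm (x - m) < d + n.+1%:R^-1.
  have [|_ [m Mm <-] dm] := @inf_adherent _ S n.+1%:R^-1 _ (conj S0 lS).
    by rewrite invr_gt0.
  by exists m.
have [l ul] : exists l, converges u l.
  apply: cauchy_converges => e e0.
  have [|N Ne] := @exists_small R (e ^+ 2 / (8 * d + 4)).
    by rewrite divr_gt0 ?exprn_gt0// ltr_wpDl// mulr_ge0.
  exists N => m n Nm Nn; pose t : R := N.+1%:R^-1.
  have t0 : 0 < t by rewrite invr_gt0.
  have t1 : t <= 1 by rewrite invf_le1// ler1n.
  have near k : (N <= k)%N -> nrm (x - u k) < d + t.
    move=> Nk; rewrite (lt_le_trans (uP k).2)// lerD2l lef_pV2 ?posrE//.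
    by rewrite ler_nat.
  have half : 2 * d <= nrm ((x - u m) + (x - u n)).
    have -> : (x - u m) + (x - u n) =
        (2%:R : R)%:C *: (x - (2^-1 : R)%:C *: (u m + u n)).
      rewrite scalerBr scalerA -rmorphM/= divff// scale1r addrACA -opprD.
      by rewrite rmorph_nat scaler_nat mulr2n.
    rewrite nrmZ nrm_real ger0_norm// ler_pM2l//; apply: dM.
    by apply: subspaceZ => //; apply: subspaceD => //; exact: (uP _).1.
  have := parallelogram nf (x - u m) (x - u n).
  have -> : (x - u m) - (x - u n) = u n - u m.
    by rewrite opprB addrC addrA subrK.
  rewrite (nrm_distC (u n)) => par.
  rewrite -(@ltr_pXn2r _ 2)// ?nnegrE ?nrm_ge0 ?(ltW e0)//.
  have sm := near m Nm; have sn := near n Nn.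
  have dt : 0 < d + t by rewrite ltr_wpDl.
  have sm2 : nrm (x - u m) ^+ 2 <= (d + t) ^+ 2.
    by rewrite ler_pXn2r ?nnegrE ?nrm_ge0 ?ltW.
  have sn2 : nrm (x - u n) ^+ 2 <= (d + t) ^+ 2.
    by rewrite ler_pXn2r ?nnegrE ?nrm_ge0 ?ltW.
  have h2 : (2 * d) ^+ 2 <= nrm ((x - u m) + (x - u n)) ^+ 2.
    by rewrite ler_pXn2r ?nnegrE ?nrm_ge0 ?mulr_ge0.
  have te : t * (8 * d + 4) < e ^+ 2.
    by rewrite -ltr_pdivlMr// ltr_wpDl// mulr_ge0.
  have tt : t ^+ 2 <= t by rewrite expr2 ler_piMl// ltW.
  lra.
have Ml : M l by apply: closed_converges ul => // n; exact: (uP n).1.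
have ld : nrm (x - l) <= d.
  apply/ler_addgt0Pr => e e0.
  have [|N1 uN1] := ul (e / 2); first by rewrite divr_gt0.
  have [|N2 N2e] := @exists_small R (e / 2); first by rewrite divr_gt0.
  pose n := maxn N1 N2.
  have := uN1 n (leq_maxl _ _); have := (uP n).2.
  have : (n.+1%:R^-1 : R) <= N2.+1%:R^-1.
    by rewrite lef_pV2 ?posrE// ler_nat ltnS leq_maxr.
  have := nrm_triangle (u n) x l.
  move: (n.+1%:R^-1) (N2.+1%:R^-1) N2e => s t te; lra.
exists l => // m Mm.
have [->|m0] := eqVneq m 0; first by rewrite linear0r.
have fm0 : '[m, m] != 0 by rewrite dnorm_eq0.
pose a := '[x - l, m] / '[m, m]; pose u' := x - l - a *: m.
have um : '[u', m] = 0 by rewrite linearBl/= formZl divfK// subrr.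
have du : d <= nrm u'.
  by rewrite /u' -addrA -opprD; apply: dM; rewrite addrC; exact: sM.2.
have : nrm (x - l) ^+ 2 = nrm u' ^+ 2 + nrm (a *: m) ^+ 2.
  by rewrite -pythagoras ?subrK// formZr um mulr0.
have := nrm_ge0 (x - l).
have := nrm_ge0 (a *: m) => am0 xl0 eq.
have /eqP : nrm (a *: m) = 0 by nra.
rewrite nrm_eq0 scaler_eq0 (negbTE m0) orbF /a mulf_eq0 invr_eq0 (negbTE fm0).
by rewrite orbF => /eqP.
Qed.

Lemma perp_unique M x p q : subspace M ->
  M p -> (forall m, M m -> '[x - p, m] = 0) ->
  M q -> (forall m, M m -> '[x - q, m] = 0) -> p = q.
Proof.
move=> sM Mp xp Mq xq; apply/eqP; rewrite -subr_eq0 -(dnorm_eq0 form).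
have Mpq : M (p - q) by exact: subspaceB.
have -> : '[p - q, p - q] = '[x - q, p - q] - '[x - p, p - q].
  rewrite -[RHS]linearBl/=; congr ('[_, _]).
  by rewrite opprB [RHS]addrC addrA subrK.
by rewrite xq// xp// subrr.
Qed.

Lemma exists_projection M : subspace M -> closed M ->
  exists P : bop H, forall x, M (P x) /\ forall m, M m -> '[x - P x, m] = 0.
Proof.
move=> sM cM.
have /choice[p pP] x : exists p, M p /\ forall m, M m -> '[x - p, m] = 0.
  by have [p Mp xp] := projection_theorem x sM cM; exists p.
have [||P PE] := bop_make (f := p).
- move=> a x y; apply: (@perp_unique M (a *: x + y)) => //.
  + exact: (pP _).1.
  + exact: (pP _).2.
  + by apply: sM.2; exact: (pP _).1.
  + move=> m Mm; rewrite opprD addrACA -scalerBr linearDl/= formZl.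
    by rewrite !(pP _).2// mulr0 addr0.
- exists 1 => x; rewrite mul1r -(@ler_pXn2r _ 2)// ?nnegrE ?nrm_ge0//.
  rewrite -[in leRHS](subrK (p x) x) pythagoras ?lerDr ?sqr_ge0//.
  by apply: (pP x).2; exact: (pP x).1.
- by exists P => x; rewrite PE; exact: pP.
Qed.

End Projection.

Definition proj {R : realType} {H : completeNormedModType R[i]}
    (form : {dot H for conjC}) (M : set H) : bop H :=
  get [set P : bop H | forall x,
    M (P x) /\ forall m, M m -> form (x - P x) m = 0].

Section ProjectionTheory.
Context {R : realType} {H : completeNormedModType R[i]}
        {form : {dot H for conjC}} {nf : norm_of_form form}.
Implicit Types (x y : H) (V W M : set H) (A B : bop H).
Local Notation "''[' x , y ]" := (form x y) : ring_scope.
Local Notation P := (proj form).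

Section FixedSubspace.
Context (M : set H) (sM : subspace M) (cM : closed M).

Let PP x : M (P M x) /\ forall m, M m -> '[x - P M x, m] = 0.
Proof.
exact: (@getPex _ [set Q : bop H | forall x, M (Q x) /\
  forall m, M m -> '[x - Q x, m] = 0] (exists_projection sM cM)).
Qed.

Lemma proj_in x : M (P M x). Proof. exact: (PP x).1. Qed.

Lemma proj_perp x m : M m -> '[x - P M x, m] = 0.
Proof. exact: (PP x).2. Qed.

Lemma proj_uniq x p : M p -> (forall m, M m -> '[x - p, m] = 0) -> P M x = p.
Proof.
by move=> Mp xp; exact: (perp_unique sM (proj_in x) (@proj_perp x) Mp xp).
Qed.

Lemma proj_id x : M x -> P M x = x.
Proof. by move=> Mx; apply: proj_uniq => // m Mm; rewrite subrr linear0l. Qed.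

Lemma proj_form x m : M m -> '[P M x, m] = '[x, m].
Proof.
by move=> Mm; rewrite -[in RHS](subrK (P M x) x) linearDl/= proj_perp// add0r.
Qed.

Lemma proj_eq0_perp x m : P M x = 0 -> M m -> '[x, m] = 0.
Proof. by move=> Px0 Mm; rewrite -proj_form// Px0 linear0l. Qed.

Lemma nrm_proj x : nrm x ^+ 2 = nrm (P M x) ^+ 2 + nrm (x - P M x) ^+ 2.
Proof.
have xP : '[x - P M x, P M x] = 0 by apply: proj_perp; exact: proj_in.
by rewrite addrC -(pythagoras xP) subrK.
Qed.

Lemma nrm_proj_le x : nrm (P M x) <= nrm x.
Proof.
by rewrite -(@ler_pXn2r _ 2)// ?nnegrE ?nrm_ge0// [leRHS]nrm_proj lerDl sqr_ge0.
Qed.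

Lemma nrm_projC_le x : nrm (x - P M x) <= nrm x.
Proof.
by rewrite -(@ler_pXn2r _ 2)// ?nnegrE ?nrm_ge0// [leRHS]nrm_proj lerDr sqr_ge0.
Qed.

(** The difference of x and its projection is orthogonal to M, hence by
    hypothesis to x, hence to itself. *)
Lemma double_perp x :
  (forall y, (forall m, M m -> '[y, m] = 0) -> '[x, y] = 0) -> M x.
Proof.
move=> xM; suff -> : x = P M x by exact: proj_in.
apply/eqP; rewrite -subr_eq0 -(dnorm_eq0 form) linearBl/= xM ?sub0r; last first.
  by move=> m; exact: proj_perp.
by rewrite form_eq0C ?oppr0//; apply: proj_perp; exact: proj_in.
Qed.

End FixedSubspace.

Lemma subspace_ominus M V : subspace M -> subspace (ominus form M V).
Proof.
move=> [M0 sM]; split; first by split=> // v _; rewrite linear0l.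
move=> a x y [Mx xV] [My yV]; split; first exact: sM.
by move=> v Vv; rewrite linearDl/= formZl xV// yV// mulr0 addr0.
Qed.

Lemma closed_ominus M V : closed M -> closed (ominus form M V).
Proof.
move=> /closed_nrmP cM; apply/closed_nrmP => x xMV; split.
  by apply: cM => e /xMV[v [Mv _] xv]; exists v.
move=> v Vv; apply: nrm_small_eq0 => e e0.
have v0 : 0 < nrm v + 1 by rewrite ltr_wpDl ?nrm_ge0.
have [|w [Mw wV] xw] := xMV (e / (nrm v + 1)); first exact: divr_gt0.
rewrite -[x](subrK w) linearDl/= wV// addr0.
rewrite (le_lt_trans (cauchy_schwarz _ _))//.
rewrite (@le_lt_trans _ _ (nrm (x - w) * (nrm v + 1)))//.
  by rewrite ler_wpM2l ?nrm_ge0// lerDl.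
by rewrite -ltr_pdivlMr.
Qed.

Lemma projC_in M V x : subspace M -> subspace V -> closed V ->
  V `<=` M -> M x -> ominus form M V (x - P V x).
Proof.
move=> sM sV cV VM Mx; split; last by move=> v; exact: proj_perp.
by apply: subspaceB => //; apply: VM; exact: proj_in.
Qed.

(** The orthogonal complement of the kernel K of a nonzero functional is a line:
    a vector z of it, suitably scaled, represents the functional. *)
Theorem riesz_representation (f : H -> R[i]) :
    (forall a x y, f (a *: x + y) = a * f x + f y) ->
    (exists M : R, forall x, nrm (f x) <= M * nrm x) ->
  exists y, forall x, f x = '[x, y].
Proof.
move=> lf [M fM].
have f0 : f 0 = 0.
  apply/eqP; rewrite -nrm_eq0 eq_le nrm_ge0 (le_trans (fM 0))//.
  by rewrite nrm0 mulr0.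
have fB x y : f (x - y) = f x - f y by rewrite addrC -scaleN1r lf mulN1r addrC.
have fZ a x : f (a *: x) = a * f x by rewrite -[_ *: _]addr0 lf f0 addr0.
pose K := [set x | f x = 0].
have sK : subspace K.
  by split=> // a x y /= fx fy; rewrite /K /= lf fx fy mulr0 addr0.
have cK : closed K.
  apply/closed_nrmP => x xK; apply: nrm_small_eq0 => e e0.
  have M0 : 0 < `|M| + 1 by rewrite ltr_wpDl.
  have [|v /= fv xv] := xK (e / (`|M| + 1)); first exact: divr_gt0.
  rewrite -[f x]subr0 -fv -fB (le_lt_trans (fM _))//.
  rewrite (@le_lt_trans _ _ ((`|M| + 1) * nrm (x - v)))//.
    by rewrite ler_wpM2r ?nrm_ge0// (le_trans (ler_norm _))// lerDl.
  by rewrite mulrC -ltr_pdivlMr.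
have [fz|/existsNP[x0 fx0]] := pselect (forall x, f x = 0).
  by exists 0 => x; rewrite fz linear0r.
pose z := x0 - P K x0.
have fz : f z = f x0 by rewrite fB (proj_in sK cK x0 : f _ = 0) subr0.
have z0 : z != 0 by apply: contra_notN fx0 => /eqP z0; rewrite -fz z0.
have fz0 : f z != 0 by rewrite fz; apply/eqP.
exists (((f z) / '[z, z])^* *: z) => x.
have : '[x - (f x / f z) *: z, z] = 0.
  apply: form_eq0C; apply: proj_perp => //.
  by rewrite /K /= fB fZ divfK// subrr.
rewrite linearBl/= => /eqP; rewrite subr_eq0 => /eqP xz.
rewrite formZr xz formZl conjCK.
by field; rewrite fz0 (dnorm_eq0 form) z0.
Qed.

Theorem exists_adjoint A : exists B : bop H, forall x y, '[A x, y] = '[x, B y].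
Proof.
have [M M0 AM] := bop_bounded A.
have /choice[b bP] y : exists z, forall x, '[A x, y] = '[x, z].
  apply: (riesz_representation (f := fun x => '[A x, y])) => [a u v|].
    by rewrite linearP linearDl/= formZl.
  exists (M * nrm y) => x; rewrite (le_trans (cauchy_schwarz _ _))//.
  by rewrite mulrAC ler_wpM2r ?nrm_ge0.
have bM y : nrm (b y) <= M * nrm y.
  have [->|b0] := eqVneq (b y) 0; first by rewrite nrm0 mulr_ge0 ?nrm_ge0// ltW.
  rewrite -(@ler_pM2l _ (nrm (b y))) ?nrm_gt0//.
  have -> : nrm (b y) * nrm (b y) = nrm '[A (b y), y].
    by rewrite bP formxx nrm_real ger0_norm ?sqr_ge0.
  rewrite (le_trans (cauchy_schwarz _ _))// mulrA ler_wpM2r ?nrm_ge0//.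
  by rewrite mulrC AM.
have [||B BE] := bop_make (f := b).
- move=> a u v; apply/eqP; rewrite -subr_eq0 -(dnorm_eq0 form).
  rewrite linearBr/= linearDr/= formZr -!bP linearDr/= formZr.
  by rewrite subrr.
- by exists M.
- by exists B => x y; rewrite BE.
Qed.

End ProjectionTheory.

(** * Cardinal sums *)

(** The cardinal sums below are sets in a sum of types, and an inequality of
    cardinals yields a total function only towards a pointed type. *)
HB.instance Definition _ (T : pointedType) (U : choiceType) :=
  isPointed.Build (T + U)%type (inl point).

Section Cardinals.
Local Open Scope card_scope.

Lemma card_leI (T U : Type) (A : set T) (B : set U) (f : T -> U) :
  (forall x, A x -> B (f x)) ->
  (forall x y, A x -> A y -> f x = f y -> x = y) -> A #<= B.
Proof.
move=> AB fI.
have /injfunPex[g] : exists2 f : T -> U, set_fun A B f & set_inj A f.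
  by exists f => // x y; rewrite !inE; exact: fI.
exact: inj_card_le g.
Qed.

Lemma card_leE (T : Type) (U : pointedType) (A : set T) (B : set U) : A #<= B ->
  exists2 f : T -> U, forall x, A x -> B (f x) &
    forall x y, A x -> A y -> f x = f y -> x = y.
Proof.
move=> /pcard_leP/injfunPex[f AB fI]; exists f => // x y Ax Ay.
by apply: fI; rewrite inE.
Qed.

Lemma card_eqE (T U : pointedType) (A : set T) (B : set U) : A #= B ->
  exists f : T -> U, [/\ forall x, A x -> B (f x),
    forall x y, A x -> A y -> f x = f y -> x = y &
    forall y, B y -> exists2 x, A x & f x = y].
Proof.
move=> /card_set_bijP[f [AB fI fS]]; exists f; split=> //.
by move=> x y Ax Ay; apply: fI; rewrite inE.
Qed.

Context {T : pointedType}.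
Implicit Types A B C D : set T.

Lemma card_add_le A B C D : A #<= C -> B #<= D ->
  card_add A B #<= card_add C D.
Proof.
move=> /card_leE[f fC fI] /card_leE[g gD gI].
apply: (card_leI (f := fun z =>
  match z with inl x => inl (f x) | inr y => inr (g y) end)).
  move=> _ [[x Ax <-]|[y By <-]].
    by left; exists (f x); auto.
  by right; exists (g y); auto.
by move=> _ _ [[x Ax <-]|[x Ax <-]] [[y Ay <-]|[y Ay <-]] // [];
  [move/fI => ->|move/gI => ->].
Qed.

Lemma card_add_eq A B C D : A #= C -> B #= D -> card_add A B #= card_add C D.
Proof.
rewrite !card_eq_le => /andP[AC CA] /andP[BD DB].
by rewrite !card_add_le.
Qed.

Lemma card_setU_add A B : A `&` B `<=` set0 -> A `|` B #= card_add A B.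
Proof.
move=> AB0; rewrite card_eq_le; apply/andP; split.
  apply: (card_leI (f := fun x => if pselect (A x) then inl x else inr x)).
    move=> x; case: pselect => [Ax _|nAx [//|Bx]]; first by left; exists x.
    by right; exists x.
  by move=> x y _ _; case: pselect => ?; case: pselect => ? // [].
apply: (card_leI (f := fun z => match z with inl x => x | inr y => y end)).
  by move=> _ [[x Ax <-]|[x Bx <-]]; [left|right].
move=> _ _ [[x Ax <-]|[x Ax <-]] [[y Ay <-]|[y Ay <-]] // xy.
- by rewrite xy.
- by case: (AB0 y); split=> //; rewrite -xy.
- by case: (AB0 x); split=> //; rewrite xy.
- by rewrite xy.
Qed.

(** With C seen as a part of D through g, the set A + D is made of A + C and of
    D minus C: the given injection is applied to the former, and the latter is
    left fixed. *)
Lemma card_add_absorb_le A B C D : card_add A C #<= card_add B C -> C #<= D ->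
  card_add A D #<= card_add B D.
Proof.
move=> /card_leE[f fBC fI] /card_leE[g gD gI].
pose G (z : T + T) : T + T :=
  match z with inl x => inl x | inr y => inr (g y) end.
have GBD z : card_add B C z -> card_add B D (G z).
  by move=> [[x Ax <-]|[x Ax <-]]; [left; exists x|right; exists (g x); auto].
have GI z w : card_add B C z -> card_add B C w -> G z = G w -> z = w.
  move=> [[x Ax <-]|[x Ax <-]] [[y Ay <-]|[y Ay <-]] //= [].
  by move/gI => ->.
pose gi y := get [set i | C i /\ g i = y].
pose h (z : T + T) : T + T := match z with
  | inl x => G (f (inl x))
  | inr y =>
      if pselect (exists2 i, C i & g i = y) then G (f (inr (gi y))) else inr y
  end.
have giP y : (exists2 i, C i & g i = y) -> C (gi y) /\ g (gi y) = y.
  by move=> [i Ci iy]; apply: (@getPex _ [set i | C i /\ g i = y]); exists i.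
have Al x : A x -> card_add A C (inl x) by left; exists x.
have Cr y : C y -> card_add A C (inr y) by right; exists y.
have GCD z y : card_add B C z -> ~ (exists2 i, C i & g i = y) -> G z <> inr y.
  by move=> [[x Ax <-]|[x Ax <-]] //= ny [xy]; apply: ny; exists x.
apply: (card_leI (f := h)).
  move=> _ [[x Ax <-]|[y Dy <-]]; rewrite /h /=; first exact/GBD/fBC/Al.
  case: pselect => [iy|ny] /=; last by right; exists y.
  exact/GBD/fBC/Cr/(giP _ iy).1.
move=> _ _ [[x Ax <-]|[x Dx <-]] [[y Ay <-]|[y Dy <-]]; rewrite /h /=.
- move=> /GI; move/(_ (fBC _ (Al _ Ax)) (fBC _ (Al _ Ay))).
  by move/fI; apply; exact: Al.
- case: pselect => [iy|ny] xy; last first.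
    by case: (GCD (f (inl x)) y _ ny xy); exact/fBC/Al.
  have [Ci _] := giP _ iy.
  move: xy => /GI; move/(_ (fBC _ (Al _ Ax)) (fBC _ (Cr _ Ci))).
  by move/fI; move/(_ (Al _ Ax) (Cr _ Ci)).
- case: pselect => [iy|ny] xy; last first.
    by case: (GCD (f (inl y)) x _ ny (esym xy)); exact/fBC/Al.
  have [Ci _] := giP _ iy.
  move: xy => /GI; move/(_ (fBC _ (Cr _ Ci)) (fBC _ (Al _ Ay))).
  by move/fI; move/(_ (Cr _ Ci) (Al _ Ay)).
- case: pselect => [ix|nx]; case: pselect => [iy|ny] // xy.
  + have [Cx <-] := giP _ ix; have [Cy <-] := giP _ iy.
    move: xy => /GI; move/(_ (fBC _ (Cr _ Cx)) (fBC _ (Cr _ Cy))).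
    by move/fI; move/(_ (Cr _ Cx) (Cr _ Cy)) => -[->].
  + by case: (GCD (f (inr (gi x))) y _ ny xy); exact/fBC/Cr/(giP _ ix).1.
  + by case: (GCD (f (inr (gi y))) x _ nx (esym xy)); exact/fBC/Cr/(giP _ iy).1.
Qed.

Lemma card_add_absorb A B C D : card_add A C #= card_add B C -> C #<= D ->
  card_add A D #= card_add B D.
Proof.
rewrite !card_eq_le => /andP[AB BA] CD.
by rewrite (card_add_absorb_le AB CD) (card_add_absorb_le BA CD).
Qed.

(** By Zorn, A is covered up to a finite remainder by disjoint injective
    sequences. As nat * nat embeds in nat, each sequence has room for countably
    many copies of itself; one of them, s0, also takes the copies of the
    remainder. *)
Lemma card_infiniteX_nat A : infinite_set A -> A `*` [set: nat] #<= A.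
Proof.
move=> Ainf.
pose P (S : set (nat -> T)) := (forall s i, S s -> A (s i)) /\
  (forall s t i j, S s -> S t -> s i = t j -> s = t /\ i = j).
have [|S [[SA SI] Smax]] := @Zorn_bigcup _ P.
  move=> F FP tot; split=> [s i [X FX Xs]|s t i j [X FX Xs] [Y FY Yt]].
    exact: (FP _ FX).1.
  have [XY|YX] := tot _ _ FX FY.
    by apply: (FP _ FY).2 => //; exact: XY.
  by apply: (FP _ FX).2 => //; exact: YX.
pose covered x := exists2 s, S s & exists i, s i = x.
(* An infinite remainder would contain one more sequence. *)
have fin : finite_set [set x | A x /\ ~ covered x].
  apply: contrapT => /infiniteP/card_leE[f fA fI].
  have nSf : ~ S f.
    by move=> Sf; have [_] := fA 0%N I; apply; exists f => //; exists 0%N.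
  apply: (Smax (S `|` [set f])).
    split; first by move=> s Ss; left.
    by move=> /(_ f) Sf; apply: nSf; apply: Sf; right.
  split=> [s i [Ss|->]|s t i j [Ss|->] [St|->]].
  - exact: SA.
  - exact: (fA i I).1.
  - exact: SI.
  - by move=> si; case: (fA j I).2; exists s => //; exists i.
  - by move=> si; case: (fA i I).2; exists t => //; exists j.
  - by move=> /fI ->.
have [s0 Ss0] : exists s, S s.
  apply: contrapT => noS; apply: Ainf; apply: sub_finite_set fin => x Ax.
  by split=> // -[s Ss _]; apply: noS; exists s.
have /countable_injP[c cI] := finite_set_countable fin.
have /choice[p pP] x : exists q : (nat -> T) * nat,
    covered x -> S q.1 /\ q.1 q.2 = x.
  have [[s Ss [i si]]|nc] := pselect (covered x); first by exists (s, i).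
  by exists (s0, 0%N).
pose code (z : nat * nat + nat * nat) : nat := pickle z.
have codeI : injective code by apply: pcan_inj; exact: pickleK.
apply: (card_leI (f := fun xn => if pselect (covered xn.1)
  then (p xn.1).1 (code (inl ((p xn.1).2, xn.2)))
  else s0 (code (inr (c xn.1, xn.2))))).
  move=> [x n] [/= Ax _]; case: pselect => [cx|ncx] /=; last exact: SA.
  exact: SA (pP x cx).1.
move=> [x n] [y m] [/= Ax _] [/= Ay _].
case: pselect => cx; case: pselect => cy /=.
- have [Sx px] := pP x cx; have [Sy py] := pP y cy.
  move=> e; have [pxy /codeI[ixy ->]] := SI _ _ _ _ Sx Sy e.
  by rewrite -px -py pxy ixy.
- by move=> e; have [_ /codeI] := SI _ _ _ _ (pP x cx).1 Ss0 e.
- by move=> e; have [_ /codeI] := SI _ _ _ _ Ss0 (pP y cy).1 e.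
- move=> e; have [_ /codeI[cxy ->]] := SI _ _ _ _ Ss0 Ss0 e.
  by congr (_, _); apply: cI => //; rewrite inE.
Qed.

End Cardinals.

(** * Hilbert dimension *)

Section Dimension.
Context {R : realType} {H : completeNormedModType R[i]}
        {form : {dot H for conjC}} {nf : norm_of_form form}.
Implicit Types (x y : H) (X Y M B C E F : set H) (T A : bop H).
Local Notation "''[' x , y ]" := (form x y) : ring_scope.
Local Notation orthonormal := (orthonormal_set form).
Local Notation basis := (orthonormal_basis form).
Local Notation hdim := (hdim form).

Lemma orthonormal_nrm B b : orthonormal B -> B b -> nrm b = 1.
Proof.
move=> oB Bb; have /eqP : nrm b ^+ 2 = 1.
  by apply: complexI; rewrite -formxx oB// eqxx.
by rewrite sqrp_eq1 ?nrm_ge0// => /eqP.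
Qed.

Lemma orthonormal_neq0 B b : orthonormal B -> B b -> b <> 0.
Proof.
move=> oB Bb b0; have /eqP := orthonormal_nrm oB Bb.
by rewrite b0 nrm0 eq_sym oner_eq0.
Qed.

(** Otherwise x, once normalized, could be added to the basis. *)
Lemma basis_perp_eq0 M B x : subspace M -> basis M B -> M x ->
  (forall b, B b -> '[x, b] = 0) -> x = 0.
Proof.
move=> sM [BM oB Bmax] Mx xB; apply/eqP; apply: contrapT => /negP x0.
pose r := (nrm x)^-1; pose e := r%:C *: x.
have eB b : B b -> '[e, b] = 0 by move=> Bb; rewrite formZl xB// mulr0.
have ee : '[e, e] = 1.
  rewrite formxx nrmZ nrm_real ger0_norm ?invr_ge0 ?nrm_ge0//.
  by rewrite mulVf ?nrm_eq0// expr1n.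
have e0 : e != 0 by rewrite -(dnorm_eq0 form) ee oner_eq0.
have : (B `|` [set e]) = B.
  apply: Bmax; last by move=> b; left.
    by move=> b [/BM//|->]; exact: subspaceZ.
  move=> b c [Bb|->] [Bc|->]; first exact: oB.
  - rewrite form_eq0C ?eB//; case: eqP => // be.
    by move: (eB _ Bb); rewrite be => /eqP; rewrite ee oner_eq0.
  - rewrite eB//; case: eqP => // ec.
    by move: (eB _ Bc); rewrite -ec => /eqP; rewrite ee oner_eq0.
  - by rewrite eqxx ee.
move=> /seteqP[/(_ e) Be _]; have /eqP := eB e (Be (or_intror erefl)).
by rewrite ee oner_eq0.
Qed.

Lemma basisI M B : B `<=` M -> orthonormal B ->
  (forall x, M x -> (forall b, B b -> '[x, b] = 0) -> x = 0) -> basis M B.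
Proof.
move=> BM oB total; split=> // C CM oC BC; apply/seteqP; split=> // c Cc.
apply: contrapT => nBc; apply: (orthonormal_neq0 oC Cc).
apply: total; first exact: CM.
move=> b Bb; rewrite oC//; last exact: BC.
by case: eqP => // cb; case: nBc; rewrite cb.
Qed.

Lemma bessel B (s : seq H) x : orthonormal B -> uniq s ->
  (forall b, b \in s -> B b) ->
  \sum_(b <- s) nrm '[x, b] ^+ 2 <= nrm x ^+ 2.
Proof.
move=> oB; elim: s x => [|b s IH] x /=; first by rewrite big_nil sqr_ge0.
move=> /andP[bs us] sB; have Bb : B b by apply: sB; rewrite mem_head.
pose y := x - '[x, b] *: b.
have bb : '[b, b] = 1 by rewrite oB// eqxx.
have yb : '[y, b] = 0 by rewrite linearBl/= formZl bb mulr1 subrr.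
have -> : nrm x ^+ 2 = nrm '[x, b] ^+ 2 + nrm y ^+ 2.
  rewrite -[in LHS](subrK ('[x, b] *: b) x) pythagoras; last first.
    by rewrite formZr yb mulr0.
  by rewrite nrmZ (orthonormal_nrm oB Bb) mulr1 addrC.
rewrite big_cons lerD2l (le_trans _ (IH y _ _))//; last first.
  by move=> c cs; apply: sB; rewrite inE cs orbT.
rewrite big_seq [leRHS]big_seq; apply: ler_sum => c cs.
rewrite linearBl/= formZl (oB b c)//; last by apply: sB; rewrite inE cs orbT.
case: eqP => [bc|_]; first by case/negP: bs; rewrite bc; exact: cs.
by rewrite mulr0 subr0.
Qed.

(** By Bessel, only finitely many coordinates exceed a given positive bound. *)
Lemma countable_coords B x : orthonormal B ->
  countable [set b | B b /\ '[x, b] != 0].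
Proof.
move=> oB; pose S (n : nat) := [set b | B b /\ n.+1%:R^-1 < nrm '[x, b] ^+ 2].
apply: (@sub_countable _ _ _ (\bigcup_n S n)).
  apply: subset_card_le => b [Bb xb0].
  have [|N Nb] := @exists_small R (nrm '[x, b] ^+ 2).
    by rewrite exprn_gt0// nrm_gt0.
  by exists N.
apply: bigcup_countable => // n _; apply: finite_set_countable.
apply: contrapT => Sinf.
have [N Nx] : exists N : nat, nrm x ^+ 2 * n.+1%:R < N%:R.
  exists (archi_bound (nrm x ^+ 2 * n.+1%:R)); apply: archi_boundP.
  by rewrite mulr_ge0 ?sqr_ge0.
have [D DS ND] := infinite_set_fset N Sinf.
have := bessel (s := finmap.enum_fset D) x oB (finmap.fset_uniq D).
move=> /(_ (fun b bD => (DS b bD).1)); apply/negP; rewrite -ltNge.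
rewrite (@lt_le_trans _ _ (\sum_(b <- finmap.enum_fset D) n.+1%:R^-1))//.
  2: { rewrite big_seq [leRHS]big_seq; apply: ler_sum => b bD.
    by apply/ltW; exact: (DS b bD).2. }
rewrite big_const_seq count_predT iter_addr_0 -[_ *+ _]mulr_natl ltr_pdivlMr//.
by rewrite (lt_le_trans Nx)// ler_nat.
Qed.

(** The images of n + 1 vectors have coordinates on at most n vectors of F, so a
    nontrivial combination of them is orthogonal to F, that is, zero. *)
Lemma injective_no_big_family T X Y E F n (e : nat -> H) :
  subspace X -> E `<=` X -> orthonormal E ->
  subspace Y -> basis Y F -> (F #<= `I_n)%card ->
  (forall x, X x -> Y (T x)) -> (forall x, X x -> T x = 0 -> x = 0) ->
  (forall i, (i <= n)%N -> E (e i)) ->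
  (forall i j, (i <= n)%N -> (j <= n)%N -> e i = e j -> i = j) -> False.
Proof.
move=> sX EX oE sY bF /card_leE[g gn gI] TXY Tinj eE eI.
pose f (j : nat) := get [set y | F y /\ g y = j].
have fg y : F y -> f (g y) = y.
  move=> Fy; have [] := @getPex _ [set z | F z /\ g z = g y].
    by exists y.
  by move=> Fz; apply: gI.
pose m : 'M[R[i]]_(n.+1, n) := \matrix_(i, j) '[T (e i), f j].
have /rowV0Pn[v /sub_kermxP vm v0] : kermx m != 0.
  by rewrite -mxrank_eq0 mxrank_ker -lt0n subn_gt0 ltnS rank_leq_col.
pose x := \sum_(i < n.+1) v ord0 i *: e i.
have ein (i : 'I_n.+1) : E (e i) by apply: eE; rewrite -ltnS.
have Xx : X x.
  rewrite /x; elim/big_ind: _ => [|y z|i _]; first exact: sX.1.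
    exact: subspaceD.
  by apply: subspaceZ => //; exact: EX.
have xe (i : 'I_n.+1) : '[x, e i] = v ord0 i.
  rewrite linear_sumlz/= (bigD1 i)//= formZl oE// eqxx mulr1.
  rewrite big1 ?addr0// => j ji.
  rewrite formZl oE//; case: eqP => [/eI|_]; last by rewrite mulr0.
  rewrite -ltnS ltn_ord -ltnS ltn_ord => /(_ isT isT) jiE.
  by move: ji; rewrite -(inj_eq val_inj) /= jiE eqxx.
suff x0 : x = 0.
  by move/eqP: v0; apply; apply/rowP => i; rewrite mxE -xe x0 linear0l.
apply: Tinj => //; apply: (basis_perp_eq0 sY bF); first exact: TXY.
move=> y Fy; have /= gy := gn _ Fy.
have := congr1 (fun w : 'rV_n => w ord0 (Ordinal gy)) vm; rewrite !mxE => vy.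
rewrite /x linear_sum linear_sumlz/= -[RHS]vy; apply: eq_bigr => i _.
by rewrite mxE/= fg// linearZ/= formZl.
Qed.

(** For finite F this is linear algebra. For infinite F, each e in E is sent to
    some f in F that is not orthogonal to T e. The fibre over f consists of
    vectors e on which the adjoint image of f has a nonzero coordinate, so it is
    countable, and F * nat has the cardinality of F. *)
Theorem orthonormal_card_le T X Y E F :
  subspace X -> E `<=` X -> orthonormal E -> subspace Y -> basis Y F ->
  (forall x, X x -> Y (T x)) -> (forall x, X x -> T x = 0 -> x = 0) ->
  (E #<= F)%card.
Proof.
move=> sX EX oE sY bF TXY Tinj.
have [/finite_setP[n Fn]|Finf] := pselect (finite_set F).
  have FIn : (F #<= `I_n)%card by move: Fn; rewrite card_eq_le => /andP[].
  have nofam := injective_no_big_family sX EX oE sY bF FIn TXY Tinj.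
  have [/finite_setP[m Em]|/infiniteP/card_leE[e eE eI]] :=
      pselect (finite_set E).
    have [mn|nm] := leqP m n.
      rewrite (card_le_eql Em) (card_le_eqr Fn).
      by rewrite card_le_II.
    have /card_leE[e eE eI] : (`I_m #<= E)%card.
      by move: Em; rewrite card_eq_le => /andP[].
    by case: (nofam e) => [i i_n|i j i_n j_n]; [apply: eE|apply: eI];
      rewrite /=; exact: leq_ltn_trans nm.
  by case: (nofam e) => [i _|i j _ _]; [apply: eE|apply: eI].
have [T' TT'] := exists_adjoint (form := form) T.
have /choice[f fP] e : exists y, E e -> F y /\ '[T e, y] != 0.
  have [Ee|nEe] := pselect (E e); last by exists 0.
  apply: contrapT => nf'; apply: (orthonormal_neq0 oE Ee).
  apply: Tinj; first exact: EX.
  apply: (basis_perp_eq0 sY bF); first exact/TXY/EX.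
  move=> y Fy; apply/eqP; apply: contrapT => /negP Ty.
  by apply: nf'; exists y.
have /choice[c cI] y : exists c : H -> nat,
    {in [set e | E e /\ '[T' y, e] != 0] &, injective c}.
  by apply/countable_injP; exact: countable_coords.
apply: card_le_trans (card_infiniteX_nat Finf).
apply: (card_leI (f := fun e => (f e, c (f e) e))).
  by move=> e Ee; split=> //; exact: (fP e Ee).1.
move=> e e' Ee Ee' [ff]; rewrite ff; apply: cI; rewrite inE; split=> //.
  have [_] := fP e Ee; rewrite ff; apply: contra_neq => Te.
  by rewrite TT' form_eq0C.
have [_] := fP e' Ee'; apply: contra_neq => Te.
by rewrite TT' form_eq0C.
Qed.

Lemma hdim_le T X Y : subspace X -> subspace Y ->
  (forall x, X x -> Y (T x)) -> (forall x, X x -> T x = 0 -> x = 0) ->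
  (hdim X #<= hdim Y)%card.
Proof.
move=> sX sY TXY Tinj; have [BX oX _] := hdimP form X.
exact: orthonormal_card_le (hdimP form Y) TXY Tinj.
Qed.

Lemma basis_card M B C : subspace M -> basis M B -> basis M C -> (B #= C)%card.
Proof.
move=> sM bB bC; have [I IE] := @bop_id R H.
have [BM oB _] := bB; have [CM oC _] := bC.
rewrite card_eq_le; apply/andP; split.
  by apply: (orthonormal_card_le (T := I) sM BM oB sM bC) => x; rewrite IE.
by apply: (orthonormal_card_le (T := I) sM CM oC sM bB) => x; rewrite IE.
Qed.

(** A basis of X and a basis of Y together form a basis of M. *)
Lemma hdim_add M X Y : subspace M -> subspace X -> subspace Y ->
  X `<=` M -> Y `<=` M -> (forall x y, X x -> Y y -> '[x, y] = 0) ->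
  (forall z, M z -> exists x y, [/\ X x, Y y & z = x + y]) ->
  (hdim M #= card_add (hdim X) (hdim Y))%card.
Proof.
move=> sM sX sY XM YM XY MXY.
have bX := hdimP form X; have bY := hdimP form Y.
have [BX oX _] := bX; have [BY oY _] := bY.
have disj b : hdim X b -> hdim Y b -> False.
  move=> Xb Yb; apply: (orthonormal_neq0 oX Xb).
  by apply/eqP; rewrite -(dnorm_eq0 form) (XY _ _ (BX _ Xb) (BY _ Yb)).
have bM : basis M (hdim X `|` hdim Y).
  apply: basisI => [b [/BX/XM//|/BY/YM//]|b c|z Mz zB].
    move=> [Xb|Yb] [Xc|Yc].
    - exact: oX.
    - rewrite (XY _ _ (BX _ Xb) (BY _ Yc)); case: eqP => // bc.
      by case: (disj b) => //; rewrite bc.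
    - rewrite (form_eq0C (XY _ _ (BX _ Xc) (BY _ Yb))); case: eqP => // bc.
      by case: (disj c) => //; rewrite -bc.
    - exact: oY.
  have [x [y [Xx Yy zxy]]] := MXY z Mz.
  have x0 : x = 0.
    apply: (basis_perp_eq0 sX bX Xx) => b Xb.
    rewrite -[RHS](zB b); last by left.
    by rewrite zxy linearDl/= (form_eq0C (XY _ _ (BX _ Xb) Yy)) addr0.
  have y0 : y = 0.
    apply: (basis_perp_eq0 sY bY Yy) => b Yb.
    rewrite -[RHS](zB b); last by right.
    by rewrite zxy linearDl/= (XY _ _ Xx (BY _ Yb)) add0r.
  by rewrite zxy x0 y0 addr0.
apply: (card_eq_trans (basis_card sM (hdimP form M) bM)).
by apply: card_setU_add => b [Xb Yb]; exact: (disj b).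
Qed.

End Dimension.

(** * Uniform boundedness and lower bounds *)

Section Majorants.
Context {R : realType} {H : completeNormedModType R[i]}.
Implicit Types (u : nat -> H) (V : set H) (A : bop H).

Lemma converges_unique u l l' : converges u l -> converges u l' -> l = l'.
Proof.
move=> ul ul'; apply/eqP; rewrite -subr_eq0; apply/eqP/nrm_small_eq0 => e e0.
have [|N uN] := ul (e / 2); first by rewrite divr_gt0.
have [|N' uN'] := ul' (e / 2); first by rewrite divr_gt0.
have := uN (maxn N N') (leq_maxl _ _); have := uN' (maxn N N') (leq_maxr _ _).
have := nrm_triangle (u (maxn N N')) l l'; rewrite (nrm_distC l (u _)); lra.
Qed.

Lemma converges_nrm_le u l x c : converges u l ->
  (exists N, forall n, (N <= n)%N -> nrm (u n - x) <= c) -> nrm (l - x) <= c.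
Proof.
move=> ul [N uN]; apply/ler_addgt0Pr => e /ul[N' uN'].
have := uN (maxn N N') (leq_maxl _ _); have := uN' (maxn N N') (leq_maxr _ _).
have := nrm_triangle (u (maxn N N')) l x; rewrite (nrm_distC l (u _)); lra.
Qed.

(** This serves for geometric series, and for operator iterations whose steps
    are controlled by the same iteration on scalars. *)
Lemma majorized_converges u (t : nat -> R) (c : R) :
  (forall n, nrm (u n.+1 - u n) <= t n.+1 - t n) -> (forall n, t n <= c) ->
  exists2 l, converges u l & forall n, nrm (l - u n) <= c - t n.
Proof.
move=> ut tc.
have tmono n k : t n <= t (n + k)%N.
  elim: k => [|k IH]; first by rewrite addn0.
  by rewrite addnS (le_trans IH)// -subr_ge0 (le_trans (nrm_ge0 _) (ut _)).
have utk n k : nrm (u (n + k)%N - u n) <= t (n + k)%N - t n.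
  elim: k => [|k IH]; first by rewrite addn0 !subrr nrm0.
  rewrite addnS; have := ut (n + k)%N.
  by have := nrm_triangle (u (n + k)%N) (u (n + k).+1) (u n); lra.
have hs : has_sup (range t).
  by split; [exists (t 0%N), 0%N|exists c => _ [n _ <-]].
have [l ul] : exists l, converges u l.
  apply: cauchy_converges => e e0.
  have [_ [N _ <-] Ne] := sup_adherent e0 hs.
  have tN n : t n <= sup (range t) by apply: (ub_le_sup hs.2); exists n.
  have key m n : (N <= m)%N -> (m <= n)%N -> nrm (u n - u m) < e.
    move=> /subnKC <- /subnKC <-; rewrite -addnA.
    set k := (m - N)%N; set j := (n - _)%N.
    have := utk (N + k)%N j; rewrite -addnA.
    by have := tmono N k; have := tN (N + (k + j))%N; lra.
  exists N => m n Nm Nn; have [mn|/ltnW nm] := leqP m n; last exact: key.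
  by rewrite nrm_distC key.
exists l => // n; apply: (converges_nrm_le ul); exists n => m /subnKC <-.
by rewrite (le_trans (utk _ _))// lerD2r.
Qed.

(** Vectors of V are Cauchy as soon as their images are. *)
Lemma closed_image_bdd_below A V c : 0 < c -> closed V ->
  subspace V -> (forall v, V v -> c * nrm v <= nrm (A v)) -> closed (A @` V).
Proof.
move=> c0 cV sV Vc; apply/closed_nrmP => y yV.
have /choice[v vP] (n : nat) : exists v, V v /\ nrm (y - A v) < n.+1%:R^-1.
  by have [|_ [v Vv <-] yv] := yV n.+1%:R^-1; [rewrite invr_gt0|exists v].
have Av : converges (A \o v) y.
  move=> e /exists_small[N Ne]; exists N => n Nn; rewrite /= nrm_distC.
  rewrite (lt_trans (vP n).2)// (le_lt_trans _ Ne)// lef_pV2 ?posrE//.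
  by rewrite ler_nat.
have [l vl] : exists l, converges v l.
  apply: cauchy_converges => e e0.
  have [|N vN] := Av (c * e / 2); first by rewrite divr_gt0// mulr_gt0.
  exists N => m n Nm Nn; rewrite -(ltr_pM2l c0).
  rewrite (le_lt_trans (Vc _ _))//.
    by apply: subspaceB => //; exact: (vP _).1.
  have := vN m Nm; have := vN n Nn; rewrite /= linearB/=.
  by have := nrm_triangle y (A (v m)) (A (v n)); rewrite (nrm_distC y); lra.
have Vl : V l by apply: closed_converges vl => // n; exact: (vP n).1.
by exists l => //; apply: converges_unique Av; exact: bop_converges.
Qed.

End Majorants.

Section UniformBoundedness.
Context {R : realType} {H : completeNormedModType R[i]}
        {form : {dot H for conjC}} {nf : norm_of_form form}.
Implicit Types (x y : H) (U V W M : set H) (A : bop H).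
Local Notation "''[' x , y ]" := (form x y) : ring_scope.

(** A gliding hump. If U is unbounded, take u n in U with a norm far larger than
    3 ^ n. Adding to or subtracting from x n a multiple of u n of length 3 ^ - n
    gives x n.+1 whose product with u n is at least 3 ^ - n * nrm (u n), since
    the two candidates differ by twice that multiple. All later corrections
    together amount to at most half of 3 ^ - n, so the limit w of the x n has
    unbounded products with the u n. *)
Theorem weakly_bounded_bounded U :
  (forall x, exists c : R, forall u, U u -> nrm '[x, u] <= c) ->
  exists c : R, forall u, U u -> nrm u <= c.
Proof.
move=> wb; apply: contrapT => nb.
pose q (n : nat) : R := 3^-1 ^+ n.
have q0 n : 0 < q n by rewrite exprn_gt0// invr_gt0.
have /choice[u uP] (n : nat) : exists u, U u /\ n%:R * 2 / q n < nrm u.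
  apply: contrapT => nu; apply: nb; exists (n%:R * 2 / q n) => u Uu.
  by rewrite leNgt; apply/negP => un; apply: nu; exists u.
have /choice[f fP] (nx : nat * H) : exists x', nrm (x' - nx.2) <= q nx.1 /\
    q nx.1 * nrm (u nx.1) <= nrm '[x', u nx.1].
  case: nx => n x /=; have un0 : 0 < nrm (u n).
    by rewrite (le_lt_trans _ (uP n).2)// divr_ge0 ?mulr_ge0// ltW.
  pose z := (q n / nrm (u n))%:C *: u n.
  have nz : nrm z = q n.
    by rewrite nrmZ nrm_real ger0_norm ?divr_ge0 ?ltW// divfK// gt_eqF.
  have zu : nrm '[z, u n] = q n * nrm (u n).
    rewrite formZl nrmM nrm_real formxx nrm_real.
    rewrite !ger0_norm ?sqr_ge0 ?divr_ge0 ?ltW//.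
    by rewrite expr2 mulrA divfK// gt_eqF.
  have [xz|xz] := lerP (q n * nrm (u n)) (nrm '[x + z, u n]).
    by exists (x + z); rewrite addrC addKr nz.
  exists (x - z); rewrite addrC addKr nrmN nz; split=> //.
  have := nrmB '[x + z, u n] '[x - z, u n].
  have -> : '[x + z, u n] - '[x - z, u n] = '[z, u n] + '[z, u n].
    by rewrite linearBl/= linearDl/=; ring.
  have -> : nrm ('[z, u n] + '[z, u n]) = 2 * nrm '[z, u n].
    rewrite (_ : _ + _ = (2%:R)%:C * '[z, u n]) ?nrmM ?nrm_real ?normr_nat//.
    by rewrite rmorph_nat mulr_natl.
  by rewrite zu; lra.
pose x := fix x n := if n is n'.+1 then f (n', x n') else (0 : H).
have xS n : nrm (x n.+1 - x n) <= - (3 / 2) * q n.+1 - - (3 / 2) * q n.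
  have := (fP (n, x n)).1; rewrite /= => /le_trans; apply.
  by rewrite /q exprS; lra.
have [|w xw wx] := majorized_converges (c := 0) xS.
  by move=> n; rewrite mulNr oppr_le0 mulr_ge0// ltW.
have [c wc] := wb w.
have [n cn] : exists n : nat, c < n%:R.
  exists (archi_bound `|c|); rewrite (le_lt_trans (ler_norm c))//.
  exact: archi_boundP.
have wn : n%:R < nrm '[w, u n].
  have /= h1 := (fP (n, x n)).2; rewrite -[f _]/(x n.+1) in h1.
  have h2 : nrm '[w - x n.+1, u n] <= q n / 2 * nrm (u n).
    rewrite (le_trans (cauchy_schwarz _ _))// ler_wpM2r ?nrm_ge0//.
    by rewrite (le_trans (wx n.+1))// /q exprS; lra.
  have := nrmB '[w, u n] '[w - x n.+1, u n].
  have -> : '[w, u n] - '[w - x n.+1, u n] = '[x n.+1, u n].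
    by rewrite linearBl/= opprB addrC subrK.
  have := (uP n).2; rewrite ltr_pdivrMr//; lra.
by have := lt_le_trans (lt_trans cn wn) (wc _ (uP n).1); rewrite ltxx.
Qed.

(** Let W be the part of the preimage of V that is orthogonal to the kernel, and
    C the adjoint of A followed by the projection onto W. The vectors v of V with
    nrm (C v) <= 1 are weakly bounded: to test them against x, replace x by its
    projection onto V, which is A w for some w in W; the product of A w and v is
    that of w and C v. So C is bounded below on V; its image is then closed, and
    it is dense in W because A is injective on W. Writing w in W as C v bounds
    the norm of w by that of A w. *)
Theorem bounded_below_of_range A V : subspace V -> closed V -> V `<=` range A ->
  exists2 c : R, 0 < c &
    forall w, ominus form (A @^-1` V) (A @^-1` [set 0]) w ->
      c * nrm w <= nrm (A w).
Proof.
move=> sV cV VA; set N := A @^-1` [set 0]; set W := ominus form (A @^-1` V) N.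
have sN : subspace N by apply: subspace_preimage; exact: subspace_zero.
have cN : closed N by apply: closed_preimage_bop; exact: closed_zero.
have sW : subspace W by apply/subspace_ominus/subspace_preimage.
have cW : closed W by apply: closed_ominus; exact: closed_preimage_bop.
have [A' AA'] := exists_adjoint (form := form) A.
have [C CE] := bop_comp (proj form W) A'.
have WC w v : W w -> '[w, C v] = '[A w, v].
  by move=> Ww; rewrite CE AA' formC proj_form// -formC.
have [K VK] : exists K : R, forall v, V v /\ nrm (C v) <= 1 -> nrm v <= K.
  apply: weakly_bounded_bounded => x.
  have [z _ zE] := VA _ (proj_in sV cV x).
  pose w := z - proj form N z.
  have Aw : A w = proj form V x.
    rewrite linearB/= (_ : A (proj form N z) = 0) ?subr0//.
    exact: (proj_in sN cN z).
  have Ww : W w.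
    split; last by move=> v Nv; exact: proj_perp.
    by rewrite /= Aw; exact: proj_in.
  exists (nrm w) => v [Vv Cv]; rewrite -(proj_form sV cV)// -Aw -WC//.
  by rewrite (le_trans (cauchy_schwarz _ _))// ler_piMr// nrm_ge0.
pose k := `|K| + 1; have k0 : 0 < k by rewrite ltr_wpDl.
have Ck v : V v -> nrm v <= k * nrm (C v).
  move=> Vv; have [Cv0|Cv0] := eqVneq (C v) 0.
    rewrite Cv0 nrm0 mulr0 leNgt; apply/negP => v0.
    have : nrm ((k / nrm v)%:C *: v) <= K.
      apply: VK; split; first exact: subspaceZ.
      by rewrite linearZ/= Cv0 scaler0 nrm0.
    rewrite nrmZ nrm_real ger0_norm; last by rewrite divr_ge0// ltW.
    rewrite divfK ?gt_eqF//.
    by apply/negP; rewrite -ltNge /k (le_lt_trans (ler_norm K))// ltrDl.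
  have Cv : 0 < nrm (C v) by rewrite nrm_gt0.
  have : nrm ((nrm (C v))^-1%:C *: v) <= K.
    apply: VK; split; first exact: subspaceZ.
    rewrite linearZ/= nrmZ nrm_real ger0_norm ?invr_ge0 ?nrm_ge0//.
    by rewrite mulVf// nrm_eq0.
  rewrite nrmZ nrm_real ger0_norm; last by rewrite invr_ge0 ltW.
  rewrite ler_pdivrMl// mulrC => /le_trans; apply; rewrite ler_pM2r// /k.
  by rewrite (le_trans (ler_norm K))// lerDl.
have cCV : closed (C @` V).
  apply: (@closed_image_bdd_below _ _ _ _ k^-1) => //.
    by rewrite invr_gt0.
  by move=> v Vv; rewrite ler_pdivrMl// Ck.
exists k^-1; first by rewrite invr_gt0.
move=> w Ww; rewrite ler_pdivrMl//.
have [v Vv wv] : (C @` V) w.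
  apply: (double_perp (subspace_image C sV) cCV) => y yC.
  apply: form_eq0C; rewrite -(proj_form sW cW)//.
  have WPy := proj_in sW cW y.
  suff -> : proj form W y = 0 by rewrite linear0l.
  apply/eqP; rewrite -(dnorm_eq0 form); apply/eqP.
  have [Vp Np] := WPy; apply: Np; rewrite /N /=.
  apply/eqP; rewrite -(dnorm_eq0 form); apply/eqP.
  rewrite -(WC _ (A (proj form W y)) (proj_in sW cW y)).
  rewrite (proj_form sW cW); last by rewrite CE; exact: proj_in.
  by apply: yC; exists (A (proj form W y)).
have [->|w0] := eqVneq w 0; first by rewrite nrm0 mulr_ge0 ?nrm_ge0// ltW.
rewrite -(@ler_pM2r _ (nrm w)) ?nrm_gt0//.
have -> : nrm w * nrm w = nrm '[A w, v].
  by rewrite -WC// wv formxx nrm_real ger0_norm ?sqr_ge0.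
rewrite (le_trans (cauchy_schwarz _ _))// mulrAC mulrC ler_wpM2r ?nrm_ge0//.
by rewrite -{1}wv Ck.
Qed.

End UniformBoundedness.

(** * Square roots of operators *)

Section SquareRoot.
Context {R : realType} {H : completeNormedModType R[i]}.
Implicit Types (x y : H) (A B S T Z : bop H).

Definition commuting A B := forall x, A (B x) = B (A x).
Definition contraction A := forall x, nrm (A x) <= nrm x.

(** One step of the iteration Y := (Z + Y ^ 2) / 2, whose fixed points satisfy
    (1 - Y) ^ 2 = 1 - Z. *)
Definition sqrt_step Z T : bop H :=
  get [set T' : bop H | forall x, T' x = (2^-1)%:C *: (Z x + T (T x))].

Lemma sqrt_stepE Z T x : sqrt_step Z T x = (2^-1)%:C *: (Z x + T (T x)).
Proof.
have [C CE] := bop_comp T T.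
apply: (@getPex _ [set T' : bop H |
  forall x, T' x = (2^-1)%:C *: (Z x + T (T x))]).
by exists ((2^-1)%:C *: (Z + C)) => z; rewrite bopZ bopD CE.
Qed.

Definition sqrt_iter Z n : bop H := iter n (sqrt_step Z) 0.
Lemma sqrt_iterS Z n x : sqrt_iter Z n.+1 x =
  (2^-1)%:C *: (Z x + sqrt_iter Z n (sqrt_iter Z n x)).
Proof. exact: sqrt_stepE. Qed.

(** The iteration for the scalar Z = 1; it increases and stays below 1. *)
Definition sqrt_majorant (n : nat) : R :=
  iter n (fun t => 2^-1 * (1 + t ^+ 2)) 0.

Lemma sqrt_majorant_bounds n :
  [/\ 0 <= sqrt_majorant n, sqrt_majorant n <= 1 &
      sqrt_majorant n <= sqrt_majorant n.+1].
Proof.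
have step (t : R) : 0 <= 2^-1 * (1 + t ^+ 2).
  by rewrite mulr_ge0 ?addr_ge0 ?sqr_ge0.
rewrite /sqrt_majorant; elim: n => [|n []]; first by split=> //=; lra.
rewrite !iterS; move: (iter n _ _) => t t0 t1 tt; split=> //.
  by have := ler_pM t0 t0 t1 t1; lra.
by rewrite ler_pM2l ?invr_gt0// lerD2l ler_pXn2r// ?nnegrE.
Qed.

Lemma sqrt_iter_commuting Z B n : commuting B Z -> commuting B (sqrt_iter Z n).
Proof.
move=> BZ; elim: n => [|n IH] x; first by rewrite /= linear0.
by rewrite !sqrt_iterS linearZ linearD/= BZ !IH.
Qed.

Lemma sqrt_iter_comm Z m n : commuting (sqrt_iter Z m) (sqrt_iter Z n).
Proof.
by apply: sqrt_iter_commuting => x; apply/esym/sqrt_iter_commuting.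
Qed.

Lemma nrm_half x : nrm ((2^-1 : R)%:C *: x) = 2^-1 * nrm x.
Proof. by rewrite nrmZ nrm_real ger0_norm. Qed.

Lemma nrm_sqrt_iter Z n x : contraction Z ->
  nrm (sqrt_iter Z n x) <= sqrt_majorant n * nrm x.
Proof.
move=> cZ; elim: n x => [|n IH] x; first by rewrite /= nrm0 mul0r.
rewrite sqrt_iterS nrm_half -mulrA.
rewrite ler_pM2l// (le_trans (nrmD _ _))// mulrDl mul1r lerD//.
have [t0 _ _] := sqrt_majorant_bounds n.
by rewrite (le_trans (IH _))// expr2 -mulrA ler_wpM2l.
Qed.

(** All iterates commute, so the difference of two consecutive iterates is half
    the product of the difference and the sum of the two preceding ones, exactly
    as for the scalar iteration. *)
Lemma nrm_sqrt_iterS Z n x : contraction Z ->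
  nrm (sqrt_iter Z n.+1 x - sqrt_iter Z n x) <=
    (sqrt_majorant n.+1 - sqrt_majorant n) * nrm x.
Proof.
move=> cZ; elim: n x => [|n IH] x.
  by rewrite -[sqrt_iter Z 0 x]/0 -[sqrt_majorant 0]/0 !subr0 nrm_sqrt_iter.
set Y1 := sqrt_iter Z n.+1; set Y0 := sqrt_iter Z n.
set t1 := sqrt_majorant n.+1; set t0 := sqrt_majorant n.
have [_ _ t01] := sqrt_majorant_bounds n.
have -> : sqrt_iter Z n.+2 x - Y1 x =
    (2^-1)%:C *: (Y1 (Y1 x + Y0 x) - Y0 (Y1 x + Y0 x)).
  rewrite sqrt_iterS -/Y1 [X in _ - X]sqrt_iterS -/Y0 -scalerBr.
  have c : Y1 (Y0 x) = Y0 (Y1 x) by exact: sqrt_iter_comm.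
  congr (_ *: _); rewrite [Y1 (_ + _)]linearD [Y0 (_ + _)]linearD /= c.
  by rewrite opprD addrACA subrr add0r opprD addrA addrK.
have -> : sqrt_majorant n.+2 - t1 = 2^-1 * ((t1 - t0) * (t1 + t0)).
  rewrite -[sqrt_majorant n.+2]/(2^-1 * (1 + t1 ^+ 2)).
  have t1E : t1 = 2^-1 * (1 + t0 ^+ 2) by [].
  by rewrite [X in _ - X]t1E; ring.
rewrite nrm_half -mulrA ler_pM2l// (le_trans (IH _))// -mulrA.
rewrite ler_wpM2l ?subr_ge0// (le_trans (nrmD _ _))// mulrDl.
by rewrite lerD//; exact: nrm_sqrt_iter.
Qed.

(** The operator 1 - Y is a square root of 1 - Z. *)
Lemma exists_sqrt Z : contraction Z ->
  exists Y : bop H, [/\ contraction Y,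
    forall B, commuting B Z -> commuting B Y &
    forall x, Y x + Y x = Z x + Y (Y x)].
Proof.
move=> cZ.
have Yc n x : nrm (sqrt_iter Z n x) <= nrm x.
  have [_ t1 _] := sqrt_majorant_bounds n.
  by rewrite (le_trans (nrm_sqrt_iter _ _ cZ))// ler_piMl ?nrm_ge0.
have /choice[f fP] x : exists l, converges (fun n => sqrt_iter Z n x) l.
  have [||l xl _] := @majorized_converges _ _ (fun n => sqrt_iter Z n x)
      (fun n => sqrt_majorant n * nrm x) (nrm x).
  - by move=> n; rewrite -mulrBl nrm_sqrt_iterS.
  - move=> n; have [_ t1 _] := sqrt_majorant_bounds n.
    by rewrite ler_piMl ?nrm_ge0.
  - by exists l.
have fc x : nrm (f x) <= nrm x.
  rewrite -[f x]subr0; apply: (converges_nrm_le (fP x)); exists 0%N => n _.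
  by rewrite subr0.
have [||Y YE] := bop_make (f := f).
- move=> a x y; apply: converges_unique (fP _) _ => e e0.
  have a0 : 0 < nrm a + 1 by rewrite ltr_wpDl ?nrm_ge0.
  have [|N xN] := fP x (e / 2 / (nrm a + 1)); first by rewrite !divr_gt0.
  have [|M yM] := fP y (e / 2); first by rewrite divr_gt0.
  exists (maxn N M) => n; rewrite geq_max => /andP[/xN xn /yM yn].
  rewrite linearP opprD addrACA -scalerBr [e in _ < e]splitr.
  rewrite (le_lt_trans (nrmD _ _))// ler_ltD// nrmZ.
  rewrite (@le_trans _ _ ((nrm a + 1) * nrm (sqrt_iter Z n x - f x)))//.
    by rewrite ler_wpM2r ?nrm_ge0// lerDl.
  by rewrite mulrC -ler_pdivlMr// ltW.
- by exists 1 => x; rewrite mul1r.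
have YP x : converges (fun n => sqrt_iter Z n x) (Y x) by rewrite YE.
exists Y; split.
- by move=> x; rewrite YE.
- move=> B BZ x; apply: (@converges_unique _ _ (fun n => sqrt_iter Z n (B x))).
    rewrite (_ : (fun n => _) = B \o (fun n => sqrt_iter Z n x)).
      exact: bop_converges.
    by apply/funext => n /=; rewrite sqrt_iter_commuting.
  exact: YP.
- move=> x.
  suff E : Y x = (2^-1)%:C *: (Z x + Y (Y x)).
    rewrite -[RHS]scale1r (_ : 1 = (2^-1)%:C + (2^-1)%:C) ?scalerDl -?E//.
    by rewrite -rmorphD/= (_ : 2^-1 + 2^-1 = 1)//; lra.
  apply: (@converges_unique _ _ (fun n => sqrt_iter Z n.+1 x)).
    by move=> e /(YP x)[N xN]; exists N => n Nn; exact: (xN n.+1 (leqW Nn)).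
  move=> e e0.
  have [N xN] := YP x e e0; have [M yM] := YP (Y x) e e0.
  exists (maxn N M) => n; rewrite geq_max => /andP[/xN xn /yM yn].
  rewrite sqrt_iterS -scalerBr nrm_half.
  have -> : Z x + sqrt_iter Z n (sqrt_iter Z n x) - (Z x + Y (Y x)) =
      sqrt_iter Z n (sqrt_iter Z n x - Y x) + (sqrt_iter Z n (Y x) - Y (Y x)).
    by rewrite linearB/= opprD addrACA subrr add0r addrA subrK.
  have := nrmD (sqrt_iter Z n (sqrt_iter Z n x - Y x))
    (sqrt_iter Z n (Y x) - Y (Y x)).
  by have := Yc n (sqrt_iter Z n x - Y x); lra.
Qed.

End SquareRoot.

(** * Spectral subspaces *)

Section SpectralSubspace.
Context {R : realType} {H : completeNormedModType R[i]}
        {form : {dot H for conjC}} {nf : norm_of_form form}.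
Implicit Types (x y : H) (A B S T Z : bop H) (M : set H).
Local Notation "''[' x , y ]" := (form x y) : ring_scope.

Definition selfadjoint S := forall x y, '[S x, y] = '[x, S y].

(** The operator B is the absolute value of S: with Z = 1 - S ^ 2, which is a
    contraction, it is the square root 1 - Y of S ^ 2, and it is positive because
    Y is a contraction. *)
Lemma exists_abs S : contraction S -> selfadjoint S ->
  exists B : bop H, [/\ forall x, 0 <= complex.Re '[B x, x],
    forall x, B (S x) = S (B x) & forall x, B (B x) = S (S x)].
Proof.
move=> cS sS; have [SS SSE] := bop_comp S S; have [I IE] := @bop_id R H.
pose Z : bop H := I - SS.
have ZE x : Z x = x - S (S x) by rewrite -SSE -[X in _ = X - _](IE x).
have cZ : contraction Z.
  move=> x; rewrite -(@ler_pXn2r _ 2)// ?nnegrE ?nrm_ge0// ZE nrm2B.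
  rewrite -sS formxx /=.
  have : nrm (S (S x)) ^+ 2 <= nrm (S x) ^+ 2.
    by rewrite ler_pXn2r ?nnegrE ?nrm_ge0// cS.
  by have := sqr_ge0 (nrm (S x)); lra.
have [Y [cY commY Ysq]] := exists_sqrt cZ.
exists (I - Y); have BE x : (I - Y : bop H) x = x - Y x.
  by rewrite -[X in _ = X - _](IE x).
split=> x; rewrite !BE.
- rewrite linearBl raddfB/= formxx/= subr_ge0.
  rewrite (le_trans (ler_Re_nrm _))// (le_trans (cauchy_schwarz _ _))//.
  by rewrite expr2 ler_wpM2r ?nrm_ge0.
- rewrite linearB/= -commY// => z.
  by rewrite !ZE linearB.
- rewrite linearB/=.
  have -> : x - Y x - (Y x - Y (Y x)) = x - (Y x + Y x) + Y (Y x).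
    by rewrite !opprD opprK !addrA.
  by rewrite Ysq ZE opprD addrA subrK opprB addrC subrK.
Qed.

(** M stands for the spectral subspace of the adjoint of A times A on the
    interval from 0 to e ^ 2. Let S be this product minus e ^ 2, scaled into a
    contraction, let B be its absolute value and let M be the kernel of B + S.
    On M one has S = - B <= 0. As B ^ 2 = S ^ 2, the range of B - S lies in M,
    so on the orthogonal complement of M the forms of S and B agree and
    S >= 0. *)
Theorem spectral_subspace A (e : R) : 0 < e -> exists M : set H,
  [/\ subspace M, closed M, (forall x, A x = 0 -> M x),
      (forall x, M x -> nrm (A x) <= e * nrm x) &
      (forall x, ominus form [set: H] M x -> e * nrm x <= nrm (A x))].
Proof.
move=> e0; have [A' AA'] := exists_adjoint (form := form) A.
have [T TE] := bop_comp A' A; have [I IE] := @bop_id R H.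
have [c c0 Tc] := bop_bounded T.
pose k := (c + e ^+ 2)^-1.
have ke0 : 0 < c + e ^+ 2 by rewrite addr_gt0 ?exprn_gt0.
have k0 : 0 < k by rewrite invr_gt0.
have [S SE] : exists S : bop H,
    forall x, S x = k%:C *: (T x - (e ^+ 2)%:C *: x).
  exists (k%:C *: (T - (e ^+ 2)%:C *: I)) => x.
  by rewrite -[X in _ = _ *: (_ - _ *: X)](IE x).
have cS : contraction S.
  move=> x; rewrite SE nrmZ nrm_real gtr0_norm// ler_pdivrMl//.
  rewrite (le_trans (nrmB _ _))// mulrDl lerD//.
  by rewrite nrmZ nrm_real ger0_norm ?sqr_ge0.
have sT : selfadjoint T.
  by move=> x y; rewrite !TE -AA' formC -AA' -formC.
have sS : selfadjoint S.
  move=> x y; rewrite !SE formZl formZr (conjc_real k : conjC _ = _).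
  congr (_ * _); rewrite linearBl linearBr/= formZl formZr.
  by rewrite (conjc_real (e ^+ 2) : conjC _ = _) sT.
have ReS x : complex.Re '[S x, x] = k * (nrm (A x) ^+ 2 - e ^+ 2 * nrm x ^+ 2).
  rewrite SE formZl linearBl/= formZl formxx TE.
  have -> : '[A' (A x), x] = (nrm (A x) ^+ 2)%:C.
    by rewrite formC -AA' formxx (conjc_real _ : conjC _ = _).
  by rewrite -!rmorphM -rmorphB -rmorphM.
have [B [B0 BS BB]] := exists_abs cS sS.
pose M := (B + S : bop H) @^-1` [set 0].
have ME x : M x <-> B x = - S x.
  have -> : M x = (B x + S x = 0) by [].
  by split=> [/eqP|->]; [rewrite addr_eq0 => /eqP|rewrite addNr].
exists M; split.
- by apply: subspace_preimage; exact: subspace_zero.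
- by apply: closed_preimage_bop; exact: closed_zero.
(* On the kernel of A, S is the scalar - s, and B, being a positive square root
   of s ^ 2, is the scalar s. *)
- move=> x Ax; pose s := k * e ^+ 2;
  have s0 : 0 < s by rewrite mulr_gt0// exprn_gt0.
  have Sx : S x = - (s%:C *: x).
    by rewrite SE TE Ax linear0 sub0r scalerN scalerA -rmorphM.
  pose v := B x - s%:C *: x.
  have Bv : B v = - (s%:C *: v).
    rewrite /v linearB linearZ/= BB Sx.
    rewrite [S (- _)]linearN /= [S (_ *: _)]linearZ /= Sx.
    by rewrite !scalerBr !scalerN !opprK opprB.
  have v0 : v = 0.
    have := B0 v; rewrite Bv linearNl/= formZl formxx.
    rewrite -rmorphM raddfN/= oppr_ge0.
    rewrite pmulr_rle0// => nv; apply/eqP; rewrite -nrm_eq0 -sqrf_eq0.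
    by rewrite eq_le nv sqr_ge0.
  by apply/ME; rewrite Sx opprK; apply/eqP; rewrite -subr_eq0; apply/eqP.
- move=> x /ME Bx; have := B0 x; rewrite Bx linearNl raddfN/= ReS oppr_ge0.
  rewrite pmulr_rle0// subr_le0 -exprMn ler_pXn2r// nnegrE ?nrm_ge0//.
  by rewrite mulr_ge0 ?nrm_ge0// ltW.
- move=> x [_ xM].
  have : complex.Re '[S x, x] = complex.Re '[B x, x].
    apply/eqP; rewrite -subr_eq0 -raddfB -linearBl/=.
    rewrite form_eq0C ?raddf0//; apply: xM; apply/ME.
    by rewrite [B _]linearB [S (_ - _)]linearB /= BS BB opprB.
  rewrite ReS => eqS; have := B0 x; rewrite -eqS.
  rewrite pmulr_rge0// subr_ge0 -exprMn ler_pXn2r// nnegrE ?nrm_ge0//.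
  by rewrite mulr_ge0 ?nrm_ge0// ltW.
Qed.

End SpectralSubspace.

(** * Isometries between subspaces of equal dimension *)

Section Isometry.
Context {R : realType} {H : completeNormedModType R[i]}
        {form : {dot H for conjC}} {nf : norm_of_form form}.
Implicit Types (x y : H) (X Y E F : set H) (K : H -> H -> Prop).
Local Notation "''[' x , y ]" := (form x y) : ring_scope.

(** K is a closed linear subspace of the product of H with itself, seen as a
    relation. *)
Definition closed_linear_relation K := [/\ K 0 0,
  forall a x y x' y', K x y -> K x' y' -> K (a *: x + x') (a *: y + y') &
  forall x y, (forall e : R, 0 < e ->
    exists x' y', [/\ K x' y', nrm (x - x') < e & nrm (y - y') < e]) -> K x y].

Lemma closed_linear_relation_form a b :
  closed_linear_relation (fun x y => '[x, a] = '[y, b]).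
Proof.
split=> [|c x y x' y' xy xy'|x y xyE]; first by rewrite !linear0l.
  by rewrite !linearDl/= !formZl xy xy'.
apply/eqP; rewrite -subr_eq0; apply/eqP/nrm_small_eq0 => e e0.
pose d := nrm a + nrm b + 1.
have d0 : 0 < d by rewrite ltr_wpDl// addr_ge0 ?nrm_ge0.
have [|x' [y' [xy' xx yy]]] := xyE (e / 2 / d); first by rewrite !divr_gt0.
have -> : '[x, a] - '[y, b] = '[x - x', a] - '[y - y', b].
  by rewrite !linearBl/= xy'; ring.
rewrite (le_lt_trans (nrmB _ _))// [e]splitr.
have small (u v : H) : nrm u < e / 2 / d -> nrm v <= d -> nrm u * nrm v < e / 2.
  move=> uc vc; rewrite (@le_lt_trans _ _ (nrm u * d))//.
    by rewrite ler_wpM2l ?nrm_ge0.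
  by rewrite -ltr_pdivlMr.
apply: ltrD; rewrite (le_lt_trans (cauchy_schwarz _ _))//.
  by rewrite small// /d -addrA lerDl addr_ge0 ?nrm_ge0.
by rewrite small// /d addrAC lerDr addr_ge0 ?nrm_ge0.
Qed.

Lemma closed_linear_relationX X Y : subspace X -> closed X -> subspace Y ->
  closed Y -> closed_linear_relation (fun x y => X x /\ Y y).
Proof.
move=> [X0 sX] /closed_nrmP cX [Y0 sY] /closed_nrmP cY; split=> //.
  by move=> a x y x' y' [Xx Yy] [Xx' Yy']; split; [exact: sX|exact: sY].
move=> x y xyE; split; [apply: cX|apply: cY] => e /xyE[x' [y' [[Xx Yy] xx yy]]].
  by exists x'.
by exists y'.
Qed.

(** Along a Cauchy sequence of the domain of an isometric relation the values
    are Cauchy too, so the domain is closed; being a closed subspace of X that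
    contains a basis of X, it is the whole of X. *)
Lemma isometric_relation_total K X E : closed_linear_relation K ->
  (forall x y, K x y -> nrm x = nrm y) -> subspace X ->
  orthonormal_basis form X E ->
  (forall x y, K x y -> X x) -> (forall e, E e -> exists y, K e y) ->
  forall x, X x -> exists y, K x y.
Proof.
move=> [K0 KL Kc] Kiso sX bE KX EK x Xx.
pose D := [set x | exists y, K x y].
have sD : subspace D.
  split; first by exists 0.
  by move=> a u v [u' uK] [v' vK]; exists (a *: u' + v'); exact: KL.
have KB u v u' v' : K u v -> K u' v' -> K (u - u') (v - v').
  move=> uv uv'; have := KL (-1) _ _ _ _ uv' uv.
  by rewrite !scaleN1r ![- _ + _]addrC.
have cD : closed D.
  apply/closed_nrmP => z zD.
  have /choice[u uP] (n : nat) : exists uv : H * H,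
      K uv.1 uv.2 /\ nrm (z - uv.1) < n.+1%:R^-1.
    by have [|u [v uv] zu] := zD n.+1%:R^-1; [rewrite invr_gt0|exists (u, v)].
  have uz : converges (fun n => (u n).1) z.
    move=> e /exists_small[N Ne]; exists N => n Nn; rewrite nrm_distC.
    rewrite (lt_trans (uP n).2)// (le_lt_trans _ Ne)// lef_pV2 ?posrE//.
    by rewrite ler_nat.
  have [w uw] : exists w, converges (fun n => (u n).2) w.
    apply: cauchy_converges => e e0.
    have [|N uN] := uz (e / 2); first by rewrite divr_gt0.
    exists N => m n Nm Nn; rewrite -(Kiso _ _ (KB _ _ _ _ (uP m).1 (uP n).1)).
    have := uN m Nm; have := uN n Nn.
    by have := nrm_triangle z (u m).1 (u n).1; rewrite (nrm_distC z); lra.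
  exists w; apply: Kc => e e0; have [N uN] := uz e e0; have [M uM] := uw e e0.
  exists (u (maxn N M)).1, (u (maxn N M)).2; split.
  - exact: (uP _).1.
  - by rewrite nrm_distC uN// leq_maxl.
  - by rewrite nrm_distC uM// leq_maxr.
suff x0 : x - proj form D x = 0.
  have xP : proj form D x = x by apply/esym/eqP; rewrite -subr_eq0 x0.
  by have [y] := proj_in sD cD x; rewrite xP; exists y.
apply: (basis_perp_eq0 sX bE).
  apply: subspaceB => //; have [y /KX//] := proj_in sD cD x.
by move=> e /EK eD; exact: proj_perp.
Qed.

(** Let f be a bijection between the bases and G the closed linear relation
    generated by the pairs (e, f e). The products of x with x' and of y with y'
    agree for generators (x, y) and (x', y'), hence on G, replacing one generator
    at a time. So G is isometric, and both G and its converse are total by the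
    preceding lemma. *)
Theorem exists_isometry X Y E F : subspace X -> closed X -> subspace Y ->
    closed Y -> orthonormal_basis form X E -> orthonormal_basis form Y F ->
    (E #= F)%card ->
  exists U : bop H, [/\ forall x, X x -> Y (U x),
    forall x, X x -> nrm (U x) = nrm x &
    forall y, Y y -> exists2 x, X x & U x = y].
Proof.
move=> sX cX sY cY bE bF /card_eqE[f [fF fI fS]].
have [EX oE _] := bE; have [FY oF _] := bF.
pose G x y := forall K, closed_linear_relation K ->
  (forall e, E e -> K e (f e)) -> K x y.
have GE e : E e -> G e (f e) by move=> Ee K _; exact.
have [G0 GL Gc] : closed_linear_relation G.
  split=> [K [K0 _ _] _ //|a x y x' y' xy xy' K KP KE|x y xyE K KP KE].
    by have [_ KL _] := KP; apply: KL; [exact: xy|exact: xy'].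
  have [_ _ Kc] := KP; apply: Kc => e /xyE[x' [y' [xy' xx yy]]].
  by exists x', y'; split=> //; exact: xy'.
have GXY x y : G x y -> X x /\ Y y.
  move=> /(_ (fun x y => X x /\ Y y)).
  apply; first exact: closed_linear_relationX.
  by move=> e Ee; split; [exact: EX|exact/FY/fF].
have GE1 e x y : E e -> G x y -> '[x, e] = '[y, f e].
  move=> Ee /(_ (fun x y => '[x, e] = '[y, f e])).
  apply; first exact: closed_linear_relation_form.
  move=> e' Ee'; rewrite oE// oF; [|exact: fF|exact: fF].
  case: eqP => [->|ne]; first by rewrite eqxx.
  by case: eqP => // /fI fe; case: ne; exact: fe.
have Gform x y x' y' : G x y -> G x' y' -> '[x, x'] = '[y, y'].
  move=> xy xy'; apply: (xy (fun x y => '[x, x'] = '[y, y'])).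
    exact: closed_linear_relation_form.
  by move=> e Ee; rewrite formC (GE1 e x' y')// -formC.
have Giso x y : G x y -> nrm x = nrm y.
  move=> xy; apply/eqP; rewrite -(@eqrXn2 _ 2)// ?nrm_ge0//; apply/eqP.
  by apply: complexI; rewrite -!formxx; exact: Gform.
have Gtot x : X x -> exists y, G x y.
  apply: (isometric_relation_total (K := G) (E := E)) => //.
  - by move=> u v /GXY[].
  - by move=> e /GE; exists (f e).
have Gsurj y : Y y -> exists x, G x y.
  apply: (isometric_relation_total (K := fun y x => G x y) (E := F)) => //.
  - split=> // [a x z x' z' xz xz'|x z xzE]; first exact: GL.
    by apply: Gc => e /xzE[x' [y' [? ? ?]]]; exists y', x'.
  - by move=> u v /Giso.
  - by move=> u v /GXY[].
  - by move=> e /fS[e' Ee' <-]; exists e'; exact: GE.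
have Guniq x y y' : G x y -> G x y' -> y = y'.
  move=> xy xy'; apply/eqP; rewrite -subr_eq0 -nrm_eq0 addrC -scaleN1r.
  by rewrite -(Giso _ _ (GL (-1) _ _ _ _ xy' xy)) scaleN1r addNr nrm0.
have /choice[u uP] x : exists y, G (proj form X x) y.
  by apply: Gtot; exact: proj_in.
have [||U UE] := bop_make (f := u).
- move=> a x y; apply: Guniq (uP _) _.
  by rewrite linearP; exact: GL (uP x) (uP y).
- by exists 1 => x; rewrite mul1r -(Giso _ _ (uP x)); exact: nrm_proj_le.
have UG x : X x -> G x (U x) by move=> Xx; rewrite UE -{1}(proj_id sX cX Xx).
exists U; split=> [x /UG/GXY[]//|x /UG/Giso//|y /Gsurj[x xy]].
have [Xx _] := GXY _ _ xy; exists x => //; exact: Guniq (UG _ Xx) xy.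
Qed.

End Isometry.

(** * The two indices *)

Section OperatorNorm.
Context {R : realType} {H : completeNormedModType R[i]}.
Implicit Types (x y : H) (A B : bop H).

Lemma nrm_bop A x : nrm (A x) <= nrm A * nrm x.
Proof.
have [->|x0] := eqVneq x 0; first by rewrite linear0 !nrm0 mulr0.
have nx0 : 0 < nrm x by rewrite nrm_gt0.
rewrite -ler_pdivrMr// mulrC -[(nrm x)^-1]ger0_norm ?invr_ge0 ?nrm_ge0//.
rewrite -nrm_real -nrmZ -linearZ/= -lecR nrmE; apply: opnorm_ub.
rewrite -nrmE nrmZ nrm_real ger0_norm ?invr_ge0 ?nrm_ge0//.
by rewrite mulVf ?gt_eqF.
Qed.

Lemma nrm_bop_le A (c : R) : 0 <= c -> (forall x, nrm (A x) <= c * nrm x) ->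
  nrm A <= c.
Proof.
move=> c0 Ac; apply: opnorm_le => x x1; rewrite -nrmE lecR.
by rewrite (le_trans (Ac x))// ler_piMr// -lecR nrmE.
Qed.

Lemma invertible_bdd_below B (c : R) : 0 < c ->
  (forall x, c * nrm x <= nrm (B x)) -> (forall y, exists x, B x = y) ->
  invertible_bop B.
Proof.
move=> c0 Bc /choice[f fP].
have BI x y : B x = B y -> x = y.
  move=> xy; apply/eqP; rewrite -subr_eq0 -nrm_eq0 eq_le nrm_ge0 andbT.
  rewrite -(ler_pM2l c0) (le_trans (Bc _))//.
  by rewrite linearB/= xy subrr nrm0 mulr0.
have [||B' BE] := bop_make (f := f).
- by move=> a x y; apply: BI; rewrite linearP/= !fP.
- by exists c^-1 => x; rewrite ler_pdivlMl// (le_trans (Bc _))// fP.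
exists B'; split; apply/funext => x /=; first by rewrite BE fP.
by apply: BI; rewrite BE fP.
Qed.

End OperatorNorm.

Section Indices.
Context {R : realType} {H : completeNormedModType R[i]}
        {form : {dot H for conjC}} {nf : norm_of_form form}.
Implicit Types (x y : H) (M N V W X Y E : set H) (A B : bop H).
Local Notation "''[' x , y ]" := (form x y) : ring_scope.
Local Notation hdim := (hdim form).
Local Notation ominus := (ominus form).
Local Notation perp := (ominus [set: H]).
Local Notation IC := (IC form).
Local Notation ker A := (bop_fun A @^-1` [set 0]).
Local Notation clrange A := (closure (range (bop_fun A))).

Lemma subspace_perp M : subspace (perp M).
Proof. exact: subspace_ominus. Qed.

Lemma closed_perp M : closed (perp M).
Proof. by apply: closed_ominus; exact: closedT. Qed.

Lemma closed_subspace_ker A : subspace (ker A) /\ closed (ker A).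
Proof.
split; first by apply: subspace_preimage; exact: subspace_zero.
by apply: closed_preimage_bop; exact: closed_zero.
Qed.

Lemma closed_subspace_clrange A : subspace (clrange A) /\ closed (clrange A).
Proof.
split; last exact: closed_closure.
by apply: subspace_closure; apply: subspace_image.
Qed.

Lemma perp_perp M : subspace M -> closed M -> perp (perp M) = M.
Proof.
move=> sM cM; apply/seteqP; split=> [x [_ xM]|x Mx]; last first.
  by split=> // v [_ vM]; rewrite form_eq0C ?vM.
by apply: (double_perp (form := form) sM cM) => y yM; apply: xM.
Qed.

Lemma perp_closure E x y : (forall v, E v -> '[v, y] = 0) -> closure E x ->
  '[x, y] = 0.
Proof.
move=> Ey /closure_nrmP xE; apply: nrm_small_eq0 => e e0.
have y0 : 0 < nrm y + 1 by rewrite ltr_wpDl ?nrm_ge0.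
have [|v Ev xv] := xE (e / (nrm y + 1)); first exact: divr_gt0.
rewrite -[x](subrK v) linearDl/= (Ey v)// addr0.
rewrite (le_lt_trans (cauchy_schwarz _ _))//.
rewrite (@le_lt_trans _ _ (nrm (x - v) * (nrm y + 1)))//.
  by rewrite ler_wpM2l ?nrm_ge0// lerDl.
by rewrite -ltr_pdivlMr.
Qed.

Lemma bop_projC V B : exists T : bop H, forall x, T x = B x - proj form V (B x).
Proof.
have [C CE] := bop_comp (proj form V) B.
by exists (B - C) => x; rewrite -CE.
Qed.

(** The orthogonal complement of W is the orthogonal sum of X and of the vectors
    orthogonal to both X and W. *)
Lemma hdim_perp X W : subspace X -> closed X -> W `<=` perp X ->
  (hdim (perp W) #= card_add (hdim X) (hdim (ominus (perp X) W)))%card.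
Proof.
move=> sX cX WX; apply: hdim_add => //.
- exact: subspace_perp.
- by apply: subspace_ominus; exact: subspace_perp.
- by move=> x Xx; split=> // w /WX[_ wX]; rewrite form_eq0C ?wX.
- by move=> x [_ xW].
- by move=> x y Xx [[_ yX] _]; rewrite form_eq0C ?yX.
move=> z [_ zW]; exists (proj form X z), (z - proj form X z); split.
- exact: proj_in.
- split; first by split=> // v; exact: proj_perp.
  move=> w Ww; rewrite linearBl/= zW// form_eq0C ?subrr//.
  by apply: (WX w Ww).2; exact: proj_in.
- by rewrite addrC subrK.
Qed.

Section BoundedBelow.
Context (A : bop H) (W : set H) (c : R).
Hypotheses (sW : subspace W) (cW : closed W) (Wker : W `<=` perp (ker A)).
Hypotheses (c0 : 0 < c) (Wc : forall w, W w -> c * nrm w <= nrm (A w)).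

Let sV : subspace (A @` W). Proof. exact: subspace_image. Qed.
Let cV : closed (A @` W). Proof. exact: closed_image_bdd_below Wc. Qed.

Lemma image_clrange : A @` W `<=` clrange A.
Proof. by move=> _ [w _ <-]; apply: subset_closure; exists w. Qed.

(** Two injective maps compare the dimensions: A followed by the projection
    orthogonal to A @` W in one direction, the adjoint of A followed by the
    projection onto the domain of the first map in the other. The second one is
    injective because A maps ker A, W and that domain together onto its range. *)
Lemma hdim_ominus_image :
  (hdim (ominus (perp (ker A)) W) #= hdim (ominus (clrange A) (A @` W)))%card.
Proof.
have [sN cN] := closed_subspace_ker A.
have [sR cR] := closed_subspace_clrange A.
set X := ominus (perp _) W; set Y := ominus _ _.
have sX : subspace X by apply: subspace_ominus; exact: subspace_perp.
have cX : closed X by apply: closed_ominus; exact: closed_perp.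
have sY : subspace Y by exact: subspace_ominus.
have in_ker x : ker A x -> perp (ker A) x -> x = 0.
  by move=> Nx [_ xN]; apply/eqP; rewrite -(dnorm_eq0 form) xN.
rewrite card_eq_le; apply/andP; split.
  have [T TE] := bop_projC (A @` W) A.
  apply: (hdim_le (T := T)) => // x.
    move=> _; rewrite TE; apply: projC_in => //; first exact: image_clrange.
    by apply: subset_closure; exists x.
  move=> [xN xW]; rewrite TE => /eqP; rewrite subr_eq0 => /eqP Ax.
  have [w Ww wx] := proj_in sV cV (A x).
  have xw : x = w.
    apply/eqP; rewrite -subr_eq0; apply/eqP; apply: in_ker.
      by rewrite /= linearB/= wx -Ax subrr.
    by apply: subspaceB => //; [exact: subspace_perp|exact: Wker].
  by apply/eqP; rewrite -(dnorm_eq0 form) {2}xw xW.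
have [A' AA'] := exists_adjoint (form := form) A.
have [T TE] := bop_comp (proj form X) A'.
apply: (hdim_le (T := T)) => // y.
  by move=> _; rewrite TE; exact: proj_in.
move=> [yR yV]; rewrite TE => y0.
apply/eqP; rewrite -(dnorm_eq0 form); apply/eqP; apply: perp_closure yR.
move=> _ [z _ <-].
pose z1 := z - proj form (ker A) z; pose w := proj form W z1.
have Az : A z = A w + A (z1 - w).
  rewrite -linearD/= [w + _]addrC subrK linearB/=.
  by rewrite (_ : A (proj form _ z) = 0) ?subr0//; exact: (proj_in sN cN z).
rewrite Az linearDl/= form_eq0C ?add0r; last first.
  by apply: yV; exists w => //; exact: proj_in.
rewrite AA' form_eq0C//; apply: (proj_eq0_perp sX cX y0).
apply: projC_in => //; first exact: subspace_perp.
by split=> // v; exact: proj_perp.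
Qed.

(** This and the next lemma turn iota_i and iota_f, with IC replaced by the
    codimension of A @` W in the closure of the range, into the codimensions of
    W and of A @` W. *)
Lemma hdim_perp_domain : (hdim (perp W) #=
  card_add (hdim (ker A)) (hdim (ominus (clrange A) (A @` W))))%card.
Proof.
have [sN cN] := closed_subspace_ker A.
apply: (card_eq_trans (hdim_perp sN cN Wker)).
by apply: card_add_eq => //; exact: hdim_ominus_image.
Qed.

Lemma hdim_perp_image : (hdim (perp (A @` W)) #=
  card_add (hdim (perp (clrange A))) (hdim (ominus (clrange A) (A @` W))))%card.
Proof.
have [sR cR] := closed_subspace_clrange A.
rewrite -{2}(perp_perp sR cR); apply: hdim_perp.
- exact: subspace_perp.
- exact: closed_perp.
- by rewrite perp_perp//; exact: image_clrange.
Qed.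

End BoundedBelow.

Lemma IC_attained A : exists V, [/\ V `<=` range A, subspace V, closed V &
  IC (range A) = hdim (ominus (clrange A) V)].
Proof.
pose K := [set hdim (ominus (clrange A) V) | V in
  [set V | [/\ V `<=` range A, submod_closed [in V] & complete_set V]]].
have [|[V [VA /subspace_submod sV /complete_setP cV] VE] _] := @card_minP _ K.
  exists (hdim (ominus (clrange A) [set 0])), [set 0] => //; split.
  - by move=> _ ->; exists 0 => //; rewrite linear0.
  - by apply/subspace_submod; exact: subspace_zero.
  - by apply/complete_setP; exact: closed_zero.
by exists V; split=> //; rewrite VE.
Qed.

Lemma IC_le A V : V `<=` range A -> subspace V -> closed V ->
  (IC (range A) #<= hdim (ominus (clrange A) V))%card.
Proof.
move=> VA sV cV; apply: (card_minP _).2.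
  by exists (hdim (ominus (clrange A) V)), V => //; split=> //;
    [apply/subspace_submod|apply/complete_setP].
by exists V => //; split=> //; [apply/subspace_submod|apply/complete_setP].
Qed.

(** Projecting orthogonally to B @` W is injective on the complement of A @` W:
    a vector B w in the kernel is orthogonal to A w, which is too close to B w
    unless w = 0. *)
Lemma hdim_perp_image_le A B W (c d : R) : 0 <= d -> d < c ->
  subspace W -> closed (B @` W) ->
  (forall w, W w -> c * nrm w <= nrm (B w)) ->
  (forall w, W w -> nrm (A w - B w) <= d * nrm w) ->
  (hdim (perp (A @` W)) #<= hdim (perp (B @` W)))%card.
Proof.
move=> d0 dc sW cB Bc AB; have sB := subspace_image B sW.
have [I IE] := @bop_id R H; have [T TE] := bop_projC (B @` W) I.
apply: (hdim_le (T := T)); [exact: subspace_perp|exact: subspace_perp| |].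
  by move=> x _; rewrite TE; split=> // v; exact: proj_perp.
move=> x [_ xA]; rewrite TE IE => /eqP; rewrite subr_eq0 => /eqP xB.
have [w Ww wx] := proj_in sB cB x; rewrite -xB in wx.
apply/eqP; rewrite -nrm_eq0 eq_le nrm_ge0 andbT leNgt; apply/negP => x0.
have w0 : 0 < nrm w.
  rewrite nrm_gt0; apply: contraTneq x0 => w0.
  by rewrite -wx w0 linear0 nrm0 ltxx.
have xx : nrm x * nrm x = nrm '[x, A w - B w].
  have xAw : '[x, A w] = 0 by apply: xA; exists w.
  by rewrite linearBr/= xAw sub0r nrmN wx formxx nrm_real ger0_norm ?sqr_ge0.
have : nrm x * nrm x <= nrm x * (d * nrm w).
  by rewrite xx (le_trans (cauchy_schwarz _ _))// ler_wpM2l ?nrm_ge0 ?AB.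
rewrite ler_pM2l// leNgt => /negP; apply.
by rewrite (@lt_le_trans _ _ (c * nrm w))// ?ltr_pM2r// -[x in leRHS]wx Bc.
Qed.

(** A vector x orthogonal to W with B x in B @` W lies in W, so it is zero. *)
Lemma hdim_perp_image_inj B W : subspace W -> closed W -> closed (B @` W) ->
  injective B -> (hdim (perp W) #<= hdim (perp (B @` W)))%card.
Proof.
move=> sW cW cB Binj; have sB := subspace_image B sW.
have [T TE] := bop_projC (B @` W) B.
apply: (hdim_le (T := T)); [exact: subspace_perp|exact: subspace_perp| |].
  by move=> x _; rewrite TE; split=> // v; exact: proj_perp.
move=> x [_ xW]; rewrite TE => /eqP; rewrite subr_eq0 => /eqP xB.
have [w Ww] := proj_in sB cB (B x); rewrite -xB => /Binj wx.
by apply/eqP; rewrite -(dnorm_eq0 form) xW// -wx.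
Qed.

Lemma hdim_perp_image_invertible B W : invertible_bop B -> subspace W ->
  closed W -> (hdim (perp W) #= hdim (perp (B @` W)))%card.
Proof.
move=> [B' [BB' B'B]] sW cW.
have BK : cancel B B' by move=> x; exact: (congr1 (@^~ x) B'B).
have B'K : cancel B' B by move=> x; exact: (congr1 (@^~ x) BB').
have BW : B @` W = B' @^-1` W.
  by apply/seteqP; split=> [_ [w Ww <-]|x /= Wx]; [rewrite /= BK|exists (B' x)].
have B'W : B' @` (B @` W) = W.
  apply/seteqP; split=> [_ [_ [w Ww <-] <-]|w Ww]; first by rewrite BK.
  by exists (B w); [exists w|].
have cB : closed (B @` W) by rewrite BW; exact: closed_preimage_bop.
rewrite card_eq_le; apply/andP; split.
  by apply: hdim_perp_image_inj => //; exact: can_inj BK.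
rewrite -[in X in (_ #<= X)%card]B'W; apply: hdim_perp_image_inj => //.
- exact: subspace_image.
- by rewrite B'W.
- exact: can_inj B'K.
Qed.

(** Choose V realizing IC (range A) and W with A @` W = V on which A is bounded
    below by c. An invertible B within c / 3 of A preserves the codimension of W,
    and B @` W is so close to A @` W that their codimensions agree. Hence W and V
    have the same codimension, and these codimensions are iota_i and iota_f. *)
Theorem closure_invertible_index A :
  closure [set B : bop H | invertible_bop B] A ->
  (iota_i form A #= iota_f form A)%card.
Proof.
move=> /closure_nrmP clA.
have [V [VA sV cV ICV]] := IC_attained A.
have [c c0 Wc] := bounded_below_of_range (form := form) sV cV VA.
have [sN cN] := closed_subspace_ker A.
set W := ominus _ _ in Wc.
have sW : subspace W by apply: subspace_ominus; exact: subspace_preimage.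
have cW : closed W by apply: closed_ominus; exact: closed_preimage_bop.
have Wker : W `<=` perp (ker A) by move=> w [_ wN].
have AW : A @` W = V.
  apply/seteqP; split=> [_ [w [Vw _] <-]//|v Vv].
  have [z _ zv] := VA v Vv; exists (z - proj form (ker A) z); last first.
    rewrite linearB/= zv (_ : A (proj form _ z) = 0) ?subr0//.
    exact: (proj_in sN cN z).
  split; last by move=> n; exact: proj_perp.
  rewrite /= linearB/= zv (_ : A (proj form _ z) = 0) ?subr0//.
  exact: (proj_in sN cN z).
have c3 : 0 < c / 3 by rewrite divr_gt0.
have [B invB AB] := clA (c / 3) c3.
have ABx x : nrm (A x - B x) <= c / 3 * nrm x.
  rewrite -[A x - B x]/((A - B : bop H) x) (le_trans (nrm_bop _ _))//.
  by rewrite ler_wpM2r ?nrm_ge0// ltW.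
have Bc w : W w -> c * (2 / 3) * nrm w <= nrm (B w).
  move=> Ww; have := Wc w Ww; have := ABx w.
  by have := nrmD (A w - B w) (B w); rewrite subrK; lra.
have dimWV : (hdim (perp W) #= hdim (perp (A @` W)))%card.
  apply: (card_eq_trans (hdim_perp_image_invertible invB sW cW)).
  have cBW : closed (B @` W) by apply: closed_image_bdd_below Bc => //; lra.
  rewrite card_eq_le; apply/andP; split.
    apply: (@hdim_perp_image_le B A W c (c / 3)) => //; [lra|lra| |].
      by rewrite AW.
    by move=> w _; rewrite nrm_distC.
  by apply: (@hdim_perp_image_le A B W (c * (2 / 3)) (c / 3)) => //; lra.
have di := hdim_perp_domain sW cW Wker c0 Wc.
have df := hdim_perp_image A W.
rewrite AW -ICV in di df.
rewrite /iota_i /iota_f.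
rewrite card_eq_sym in di; apply: (card_eq_trans di).
by apply: card_eq_trans df; rewrite -AW.
Qed.

(** Let W be the orthogonal complement of a spectral subspace M on which A is
    small. The codimension of A @` W in the closure of the range is at least
    IC (range A), so that equality of the indices persists when it replaces
    IC (range A): W and A @` W have the same codimension. An invertible operator
    near A is A on W and a small multiple of an isometry from the complement of W
    onto that of A @` W. *)
Theorem index_closure_invertible A : (iota_i form A #= iota_f form A)%card ->
  closure [set B : bop H | invertible_bop B] A.
Proof.
move=> ind; apply/closure_nrmP => e e0.
pose d := e / 4; have d0 : 0 < d by rewrite divr_gt0.
have d0' := ltW d0.
have [M [sM cM MN Md Wd]] := spectral_subspace (form := form) A d0.
pose W := perp M.
have sW : subspace W by exact: subspace_perp.
have cW : closed W by exact: closed_perp.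
have Wker : W `<=` perp (ker A) by move=> w [_ wM]; split=> // n /MN /wM.
pose V := A @` W.
have sV : subspace V by exact: subspace_image.
have cV : closed V by exact: closed_image_bdd_below Wd.
have ICV : (IC (range A) #<= hdim (ominus (clrange A) V))%card.
  by apply: IC_le => // _ [w _ <-]; exists w.
have dimWV : (hdim (perp W) #= hdim (perp V))%card.
  apply: (card_eq_trans (hdim_perp_domain sW cW Wker d0 Wd)).
  rewrite card_eq_sym; apply: (card_eq_trans (hdim_perp_image A W)).
  by rewrite card_eq_sym; exact: card_add_absorb ind ICV.
have [U [UV Unrm Usurj]] := exists_isometry (subspace_perp W) (@closed_perp W)
  (subspace_perp V) (@closed_perp V) (hdimP form _) (hdimP form _) dimWV.
have perpW x : perp W (x - proj form W x) by split=> // w; exact: proj_perp.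
have [I IE] := @bop_id R H; have [Q QE] := bop_projC W I.
have [AP APE] := bop_comp A (proj form W); have [UQ UQE] := bop_comp U Q.
pose B : bop H := AP + d%:C *: UQ.
have BE x : B x = A (proj form W x) + d%:C *: U (x - proj form W x).
  by rewrite -[B x]/(AP x + d%:C *: UQ x) APE UQE QE IE.
exists B.
  apply: (@invertible_bdd_below _ _ _ d) => // [x|y].
    rewrite -(@ler_pXn2r _ 2)// ?nnegrE ?(mulr_ge0 d0') ?nrm_ge0//.
    rewrite BE pythagoras; last first.
      rewrite formZr form_eq0C ?mulr0//; apply: (UV _ (perpW x)).2.
      by exists (proj form W x) => //; exact: proj_in.
    rewrite nrmZ nrm_real gtr0_norm// Unrm// exprMn (nrm_proj sW cW x) mulrDr.
    rewrite -!exprMn lerD// ler_pXn2r// ?nnegrE ?(mulr_ge0 d0') ?nrm_ge0//.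
    by apply: Wd; exact: proj_in.
  have [w Ww wy] := proj_in sV cV y.
  have yV : perp V (y - proj form V y) by split=> // v; exact: proj_perp.
  have [u Wu uy] := Usurj _ yV.
  exists (w + d^-1%:C *: u).
  have Pw : proj form W (w + d^-1%:C *: u) = w.
    apply: proj_uniq => // v Wv; rewrite addrAC subrr add0r formZl.
    by rewrite Wu.2 ?mulr0.
  rewrite BE Pw addrAC subrr add0r linearZ/= uy wy scalerA -rmorphM/=.
  rewrite divff ?gt_eqF//.
  by rewrite scale1r addrC subrK.
apply: (@le_lt_trans _ _ (2 * d)); last by rewrite /d; lra.
apply: nrm_bop_le => [|x]; first by rewrite mulr_ge0// ltW.
rewrite -[(A - B : bop H) x]/(A x - B x) BE opprD addrA -linearB/=.
set z := x - _; have zW : perp W z := perpW x.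
have Mz : M z by rewrite -(perp_perp sM cM).
rewrite (le_trans (nrmB _ _))// nrmZ nrm_real gtr0_norm// Unrm//.
rewrite (@le_trans _ _ (2 * d * nrm z))//; first by have := Md z Mz; lra.
by apply: ler_wpM2l; [exact: mulr_ge0|exact: nrm_projC_le].
Qed.

End Indices.

Theorem corollary3p13 (R : realType) (H : completeNormedModType R[i])
    (form : {dot H for conjC})
    (norm_form : forall x : H, `|x| ^+ 2 = form x x) :
  closure [set A : bop H | invertible_bop A] =
  [set A : bop H | (iota_i form A #= iota_f form A)%card].
Proof.
apply/seteqP; split=> A.
- exact: (closure_invertible_index (nf := norm_form)).
- exact: (index_closure_invertible (nf := norm_form)).
Qed.
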